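(* For any field $k$ of prime characteristic $p$ and any integer $d\geq 2$, there is a curve $C\subset\mathbb{P}^2_k$ of degree $d$ whose Hilbert-Kunz multiplicity equals $\frac{3}{4}d$, and this is the minimum possible Hilbert-Kunz multiplicity for curves of degree $d$ in $\mathbb{P}^2_k$.
   Context: A curve of degree $d$ in $\mathbb{P}^2_k$ is the subscheme defined by a nonzero homogeneous polynomial $f\in S=k[x,y,z]$ of degree $d$ (not necessarily irreducible or reduced). With $R=S/(f)$, its Hilbert-Kunz function is $HK_R(q)=\dim_k S/(f,x^q,y^q,z^q)$ for $q=p^n$, $n\in\mathbb{N}$, and its Hilbert-Kunz multiplicity is the real number $c$ with $HK_R(q)=cq^2+O(q)$, i.e. $c=\lim_{n\to\infty}HK_R(p^n)/p^{2n}$ (this limit exists by a theorem of Monsky). *)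

(* Defs.v *)
From mathcomp Require Import all_boot all_order all_algebra.
(* mpoly must be imported before the MathComp-Analysis files: in the other
   order their notations are incompatible. *)
From mathcomp Require Import mpoly.
From mathcomp Require Import boolp classical_sets reals topology normedtype.
From mathcomp Require Import sequences.

Set Implicit Arguments.
Unset Strict Implicit.
Unset Printing Implicit Defensive.

Import Order.TTheory GRing.Theory Num.Theory numFieldNormedType.Exports.
Local Open Scope classical_set_scope.
Local Open Scope ring_scope.

Definition ideal_gen (A : comNzRingType) (gs : seq A) : set A :=
  [set a | exists c : 'I_(size gs) -> A, a = \sum_i c i * gs`_i].

Definition basis_mod (k : fieldType) (A : lmodType k) (I : set A) (m : nat)
    (b : 'I_m -> A) : Prop :=
  (forall c : 'I_m -> k, I (\sum_i c i *: b i) -> forall i, c i = 0) /\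
  (forall a : A, exists c : 'I_m -> k, I (a - \sum_i c i *: b i)).

(* The dimension of A / I over k for a k-subspace I of A, with value 0 when
   A / I is infinite-dimensional. *)
Definition quot_dim (k : fieldType) (A : lmodType k) (I : set A) : nat :=
  xget 0%N [set m | exists b : 'I_m -> A, basis_mod I b].

Definition plane_curve (k : fieldType) (d : nat) (f : {mpoly k[3]}) : Prop :=
  f != 0 /\ f \is d.-homog.

Definition HK_ideal (k : fieldType) (f : {mpoly k[3]}) (q : nat) :
    set {mpoly k[3]} :=
  ideal_gen (f :: [seq 'X_i ^+ q | i : 'I_3]).

Definition HK (k : fieldType) (f : {mpoly k[3]}) (q : nat) : nat :=
  quot_dim (HK_ideal f q).

(* A relation, since the existence of the limit is a theorem. *)
Definition HK_multiplicity (R : realType) (k : fieldType) (p : nat)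
    (f : {mpoly k[3]}) (c : R) : Prop :=
  (fun n : nat => (HK f (p ^ n))%:R / (p ^ (2 * n))%:R : R) @ \oo --> c.

(* Main.v *)
(* Write [q = p^n] and [A = k[x,y,z]/(x^q,y^q,z^q)]; then [HK(q)] is the
   corank of multiplication by [f] on [A].

   Lower bound: in degrees at most [M ~ 3q/2] the image of [f] has dimension at
   most [dim A_(<= M-d)], so [HK(q)] is at least the number of monomials of [A]
   of degree in ]M-d, M], which is [3/4 d q^2 + O(q)].

   Coranks are subadditive under composition, hence it suffices to reach the
   bound for a conic and for a cubic.  Take [f = x^d - h], [deg_x h < d];
   reducing a power of [x] modulo [f] gives a form [G(y,z)] of degree [q + O(1)]
   in the ideal, so that [HK(q) <= d dim k[y,z]/(y^q,z^q,G)], which is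
   [3/4 d q^2 + O(q)] as soon as [y^q, z^q, G] have no syzygy of degree smaller
   than [3q/2 - O(1)].  Three curves are used:
   - [x^2 = yz], where [G] is a monomial;
   - [x^3 = yz(y+z)] if [p <> 3], where the absence of syzygies is Han's theorem
     on the syzygy gap of [y^a, z^b, (y+z)^c] near [q(2/3, 2/3, 1/3)], obtained
     by a Mason-Stothers argument: a vanishing Wronskian makes the syzygy
     a Frobenius pullback, up to a common factor;
   - the Artin-Schreier cover [x^3 - xz^2 = y^2 z] if [p = 3], where it says that
     [sum_j t^(2 3^j)] is badly approximable by rational functions, again by
     Frobenius descent on a vanishing Wronskian. *)
Require Import Defs.
From mathcomp Require Import all_boot all_order all_algebra.
From mathcomp Require Import mpoly.
From mathcomp Require Import boolp classical_sets reals topology normedtype.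
From mathcomp Require Import sequences.
From mathcomp Require Import ring lra zify.

Set Implicit Arguments.
Unset Strict Implicit.
Unset Printing Implicit Defensive.
Import Order.TTheory GRing.Theory Num.Theory numFieldNormedType.Exports.
Local Open Scope classical_set_scope.
Local Open Scope ring_scope.

(** * Frobenius descent of syzygies in two variables *)

Lemma deriv_eq0_comp_Xp (k : fieldType) (p : nat) (U : {poly k}) :
  p \in [pchar k] -> U^`() = 0 -> exists u, U = u \Po 'X^p.
Proof.
move=> pc U0; have p_gt0 := prime_gt0 (pcharf_prime pc).
exists (\poly_(i < size U) U`_(p * i)); apply/polyP=> i.
rewrite coef_comp_poly_Xn // coef_poly.
have [/dvdnP[j ->]|ndvd] := boolP (p %| i)%N.
  rewrite mulnK // [(j * p)%N]mulnC; case: ltnP => // le_sz.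
  by rewrite nth_default //; apply: leq_trans le_sz (leq_pmull _ _).
case: i ndvd => [|i ndvd]; first by rewrite dvdn0.
have := congr1 (fun q : {poly k} => q`_i) U0; rewrite coef_deriv coef0 => /eqP.
by rewrite -mulr_natr mulf_eq0 -(dvdn_pcharf pc) (negPf ndvd) orbF => /eqP.
Qed.

(** Once the gcd is divided out, each of the two cofactors divides the product of its own derivative
    with the other one, hence divides its derivative by coprimality. By degrees that derivative is
    zero, so the cofactor is a polynomial in ['X^p]. *)
Lemma wronskian_eq0 (k : fieldType) (p : nat) (U V : {poly k}) :
  p \in [pchar k] -> U != 0 -> U * V^`() = U^`() * V ->
  exists M u v : {poly k}, U = M * (u \Po 'X^p) /\ V = M * (v \Po 'X^p).
Proof.
move=> pc U0 W; pose g := gcdp U V.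
have g0 : g != 0 by rewrite gcdp_eq0 negb_and U0.
have eU : U = U %/ g * g by rewrite divpK ?dvdp_gcdl.
have eV : V = V %/ g * g by rewrite divpK ?dvdp_gcdr.
have cop : coprimep (U %/ g) (V %/ g).
  by apply: coprimep_div_gcd; rewrite U0.
move: (U %/ g) (V %/ g) => U1 V1 in eU eV cop *.
have W1 : U1 * V1^`() = U1^`() * V1.
  apply: (mulIf (mulf_neq0 g0 g0)); move: W; rewrite eU eV !derivM => W.
  apply/eqP; rewrite -subr_eq0; apply/eqP.
  by move/eqP: W; rewrite -subr_eq0 => /eqP <-; ring.
have deriv_small (P Q : {poly k}) : coprimep P Q -> P %| P^`() * Q -> P^`() = 0.
  move=> cPQ; rewrite Gauss_dvdpl // => dv.
  apply/eqP/negPn/negP => nz; have := dvdp_leq nz dv; apply/negP.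
  by rewrite -ltnNge lt_size_deriv //; apply: contraNneq nz => ->; rewrite deriv0.
have [u eu] : exists u, U1 = u \Po 'X^p.
  apply: deriv_eq0_comp_Xp (pc) _; apply: deriv_small cop _.
  by rewrite -W1 dvdp_mulIl.
have [v ev] : exists v, V1 = v \Po 'X^p.
  apply: deriv_eq0_comp_Xp (pc) _; apply: (deriv_small _ U1).
    by rewrite coprimep_sym.
  by rewrite mulrC W1 dvdp_mulIr.
by exists g, u, v; rewrite -eu -ev ![g * _]mulrC.
Qed.

Lemma size_comp_Xp (k : fieldType) (p : nat) (u : {poly k}) :
  (size (u \Po 'X^p)).-1 = ((size u).-1 * p)%N.
Proof. by rewrite size_comp_poly size_polyXn. Qed.

(** As [x] is fixed by Frobenius, substituting ['X^p] in ['X - x] gives [('X - x)^p], and the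
    cofactor still does not vanish at [x]. *)
Lemma mup_comp_Xp (k : fieldType) (p : nat) (x : k) (u : {poly k}) :
  p \in [pchar k] -> x ^+ p = x -> u != 0 ->
  mup x (u \Po 'X^p) = (p * mup x u)%N.
Proof.
move=> pc xp u0; have [n [v nrv ->]] := multiplicity_XsubC u x.
rewrite u0 /= in nrv; have p_gt0 := prime_gt0 (pcharf_prime pc).
have pcP : p \in [pchar {poly k}] by rewrite pchar_poly.
have -> : (v * ('X - x%:P) ^+ n) \Po 'X^p
          = (v \Po 'X^p) * ('X - x%:P) ^+ (p * n).
  rewrite comp_polyM rmorphXn rmorphB /= comp_polyX comp_polyC.
  rewrite exprM; congr (_ * _ ^+ _).
  have := pFrobenius_autB_comm pcP (mulrC 'X x%:P).
  by rewrite !pFrobenius_autE -polyC_exp xp => ->.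
by rewrite !mupMr ?mup_XsubCX ?eqxx // /root horner_comp hornerXn xp.
Qed.

Lemma dvdp_deriv_XsubCX (k : fieldType) (x : k) (a : nat) (U : {poly k}) :
  ('X - x%:P) ^+ a %| U -> ('X - x%:P) ^+ a.-1 %| U^`().
Proof.
case: a => [_|a /dvdpP[Q ->]]; first exact: dvd1p.
rewrite derivM deriv_exp derivXsubC mul1r /=.
apply: dvdp_add; first by rewrite exprS mulrA dvdp_mulIr.
by rewrite -mulr_natl mulrA dvdp_mulIr.
Qed.

(* Over a fieldType these statements use a single coercion path to the ring of
   coefficients, without which lia does not identify the sizes. *)
Lemma size_mul_leqf (k : fieldType) (P Q : {poly k}) :
  (size (P * Q)%R <= (size P + size Q).-1)%N.
Proof. exact: size_polyMleq. Qed.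

Lemma lt_size_derivf (k : fieldType) (P : {poly k}) :
  P != 0 -> (size P^`() < size P)%N.
Proof. exact: lt_size_deriv. Qed.

Lemma size_mulf (k : fieldType) (P Q : {poly k}) : P != 0 -> Q != 0 ->
  size (P * Q) = (size P + size Q).-1.
Proof. exact: size_mul. Qed.

Lemma dvdp_leqf (k : fieldType) (P Q : {poly k}) :
  Q != 0 -> P %| Q -> (size P <= size Q)%N.
Proof. exact: dvdp_leq. Qed.

Definition absdiff (m n : nat) : nat := ((m - n) + (n - m))%N.

Lemma absdiffMl (p m n : nat) : (p * absdiff m n = absdiff (p * m) (p * n))%N.
Proof. by rewrite /absdiff mulnDr !mulnBr. Qed.

(* As a form of degree [D], [V] vanishes to order [b] at infinity.  The number
   [a + b + c - 2 D] is the syzygy gap: it is at most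
   [p^s] minus the taxicab distance from [(a, b, c)] to a point of [p^s Z^3].
   If it exceeds 1 then the degree of the Wronskian of [U] and [V] is too small
   for its zeros at [x] and [y], and the syzygy descends along [t |-> t^p]. *)
Lemma mason_descent (k : fieldType) (p : nat) (x y : k) :
  p \in [pchar k] -> x ^+ p = x -> y ^+ p = y -> x != y ->
  forall (D a b c : nat) (U V : {poly k}),
  U != 0 -> V != 0 -> U + V != 0 ->
  (size U <= D.+1)%N -> (size V + b <= D.+1)%N ->
  ('X - x%:P) ^+ a %| U -> ('X - y%:P) ^+ c %| U + V ->
  exists s a' b' c' : nat,
   (absdiff a (p ^ s * a') + absdiff b (p ^ s * b') + absdiff c (p ^ s * c') +
    (a + b + c) <= p ^ s + 2 * D)%N /\ ((0 < D)%N -> (p ^ s <= D)%N).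
Proof.
move=> pc xp yp xy; have p_gt1 := prime_gt1 (pcharf_prime pc).
elim/ltn_ind=> D IH a b c U V U0 V0 UV0 sU sV dU dUV.
(* A gap of at most 1 is settled by [s = 0], with [(a, b, c)] itself as the point of Z^3. *)
have [small|large] := leqP (a + b + c) (2 * D).+1.
  by exists 0, a, b, c; rewrite /absdiff expn0; split; lia.
have W : U * V^`() = U^`() * V.
  apply/eqP; rewrite -subr_eq0; apply/negPn/negP => W0.
  have dxW : ('X - x%:P) ^+ a.-1 %| U * V^`() - U^`() * V.
    apply: dvdp_sub.
      by apply: dvdp_mulr; apply: dvdp_trans dU; rewrite dvdp_exp2l ?leq_pred.
    exact/dvdp_mulr/dvdp_deriv_XsubCX.
  have dyW : ('X - y%:P) ^+ c.-1 %| U * V^`() - U^`() * V.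
    (* The Wronskian is unchanged when [U + V] replaces [V], which reveals its zeros at [y]. *)
    have -> : U * V^`() - U^`() * V = U * (U + V)^`() - U^`() * (U + V).
      by rewrite derivD; ring.
    apply: dvdp_sub; first exact/dvdp_mull/dvdp_deriv_XsubCX.
    by apply: dvdp_mull; apply: dvdp_trans dUV; rewrite dvdp_exp2l ?leq_pred.
  have cop : coprimep (('X - x%:P) ^+ a.-1) (('X - y%:P) ^+ c.-1).
    by rewrite coprimep_expl // coprimep_expr // coprimep_XsubC2 // subr_eq0 eq_sym.
  have /(dvdp_leq W0) : ('X - x%:P) ^+ a.-1 * ('X - y%:P) ^+ c.-1
                          %| U * V^`() - U^`() * V by rewrite Gauss_dvdp ?dxW.
  have sx := size_exp_XsubC a.-1 x; have sy := size_exp_XsubC c.-1 y.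
  rewrite size_mulf -?size_poly_gt0 ?sx ?sy //.
  have := size_polyD (U * V^`()) (- (U^`() * V)); rewrite size_polyN.
  move: (size_mul_leqf U V^`()) (size_mul_leqf U^`() V) sU sV large.
  move: (lt_size_derivf U0) (lt_size_derivf V0); clear.
  move: (size (U * V^`() - U^`() * V)) (size (U * V^`())) (size (U^`() * V)).
  by move: (size U) (size V) (size U^`()) (size V^`()) => *; lia.
have [M [u [v [eU eV]]]] := wronskian_eq0 pc U0 W.
have eUV : U + V = M * ((u + v) \Po 'X^p) by rewrite comp_polyD mulrDr -eU -eV.
have nz w : M * (w \Po 'X^p) != 0 -> [/\ M != 0, w \Po 'X^p != 0 & w != 0].
  rewrite mulf_eq0 negb_or => /andP[-> h]; split=> //.
  by apply: contraNneq h => ->; rewrite comp_poly0.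
move: (U0) (V0) (UV0); rewrite eUV eU eV => /nz[M0 cu0 u0] /nz[_ cv0 v0] /nz[_ cw0 w0].
set d := maxn (size u).-1 (size v).-1.
move: dU sU sV dUV; rewrite eUV eU eV -!mup_geq ?mulf_neq0 //.
rewrite !mupM // !mup_comp_Xp // !size_mulf //.
have su := size_comp_Xp p u; have sv := size_comp_Xp p v.
have sM : (mup x M + mup y M <= (size M).-1)%N.
  have cop : coprimep (('X - x%:P) ^+ mup x M) (('X - y%:P) ^+ mup y M).
    by rewrite coprimep_expl // coprimep_expr // coprimep_XsubC2 // subr_eq0 eq_sym.
  have /(dvdp_leq M0) : ('X - x%:P) ^+ mup x M * ('X - y%:P) ^+ mup y M %| M.
    by rewrite Gauss_dvdp // -!mup_geq // !leqnn.
  rewrite size_mulf -?size_poly_gt0 ?(size_exp_XsubC _ x) ?(size_exp_XsubC _ y) //.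
  by rewrite addSn addnS => h; rewrite -ltnS prednK // size_poly_gt0.
move: su sv (M0) (cu0) (cv0) (u0) (v0); rewrite -!size_poly_gt0.
move=> su sv M0' cu0' cv0' u0' v0' dU sU sV dUV.
have dvu : (mup x u <= (size u).-1)%N.
  have : ('X - x%:P) ^+ mup x u %| u by rewrite -mup_geq.
  by move/(dvdp_leqf u0); rewrite size_exp_XsubC; clear; lia.
have dvw : (mup y (u + v)%R <= d)%N.
  have : ('X - y%:P) ^+ mup y (u + v) %| u + v by rewrite -mup_geq.
  move/(dvdp_leqf w0); rewrite size_exp_XsubC /d.
  by move: (size_polyD u v); clear; lia.
have pd : (p * d + (size M).-1 <= D)%N.
  rewrite /d maxnMr ![(p * _)%N]mulnC -su -sv.
  by move: sU sV M0' cu0' cv0'; clear; lia.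
have ed : ((size v).-1 <= d)%N by rewrite leq_maxr.
have le_b : (b + p * (size v).-1 + (size M).-1 <= D)%N.
  by rewrite [(p * _)%N]mulnC -sv; move: sV M0' cv0'; clear; lia.
(* If [u] and [v] were constant, [M] alone would carry the zeros: [a + c <= deg M] and
   [b + deg M <= D] contradict the large gap. *)
have d_gt0 : (0 < d)%N.
  rewrite lt0n; apply/eqP=> d0; move: dvu dvw ed pd le_b dU dUV sM large.
  have -> : (size u).-1 = 0%N by apply/eqP; rewrite -leqn0 -d0 leq_maxl.
  rewrite d0 !leqn0 => /eqP-> /eqP-> /eqP->.
  by rewrite !muln0; clear; lia.
have ltdD : (d < D)%N.
  by move: (leq_mul p_gt1 (leqnn d)) pd d_gt0; clear; lia.
(* As a form of degree [d], [v] vanishes to order [d - deg v] at infinity. *)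
have [||||s [a' [b' [c' [IHs le_s]]]]] := IH d ltdD (mup x u) (d - (size v).-1)%N
  (mup y (u + v)%R) u v u0 v0 w0.
- by rewrite -[size u]prednK // ltnS leq_maxl.
- by move: ed v0'; clear; lia.
- by rewrite -mup_geq.
- by rewrite -mup_geq.
exists s.+1, a', b', c'; split; last first.
  move=> _; rewrite expnS; apply: leq_trans (leq_mul (leqnn p) (le_s d_gt0)) _.
  by apply: leq_trans pd; apply: leq_addr.
(* The function [t |-> |t - t0| + t] is nondecreasing and grows at most twice as fast as [t]. So
   passing from [p] times the descended orders to [a], [b], [c] costs at most twice
   [mup x M + mup y M + (D - deg M - p * d)], which [sM] bounds by [2 * (D - p * d)]. *)
have := leq_mul (leqnn p) IHs; move: dU dUV le_b pd sM ed; clear.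
set b1 := (d - _)%N; move: (mup x M) (mup y M) (mup x u) (mup y (u + v)) (size M).-1.
move=> al ga a1 c1 mu dU dUV le_b pd sM ed.
have -> : (p * (absdiff a1 (p ^ s * a') + absdiff b1 (p ^ s * b')
               + absdiff c1 (p ^ s * c') + (a1 + b1 + c1)) =
   absdiff (p * a1) (p ^ s.+1 * a') + absdiff (p * b1) (p ^ s.+1 * b')
  + absdiff (p * c1) (p ^ s.+1 * c') + (p * a1 + p * b1 + p * c1))%N.
  by rewrite expnS -!mulnA -!absdiffMl -!mulnDr.
rewrite mulnDr -expnS mulnCA {}/b1 mulnBr; move: dU dUV le_b pd.
move: (leq_mul (leqnn p) ed) sM; clear.
move: (p * a1)%N (p * c1)%N (p * d)%N (p * (size v).-1)%N (p ^ s.+1)%N.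
move=> pa1 pc1 pd pv P; move: (P * a')%N (P * b')%N (P * c')%N => xa xb xc.
by rewrite /absdiff; lia.
Qed.

(* A form [c(y, z)] of degree [m] with [c G] in [(y^q, z^q)] is zero, where [G] is
   the homogenization of [phi] in degree [E]; forms are dehomogenized at [z = 1]. *)
Definition nondegenerate (k : fieldType) (phi : {poly k}) (E m q : nat) :=
  forall c : {poly k}, (size c <= m.+1)%N ->
  (forall i, (i < q)%N -> (m + E < i + q)%N -> (c * phi)`_i = 0) -> c = 0.

(** Multiplication by ['X^e] only shifts the coefficients of [c], and [m + e < q] keeps all of them
    in the range where the product is assumed to vanish. *)
Lemma nondegenerate_conic (k : fieldType) (e m q : nat) :
  (m + e < q)%N -> nondegenerate ('X^e : {poly k}) (2 * e) m q.
Proof.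
move=> meq c sc h; apply/polyP=> j; rewrite coef0.
have [jm|] := leqP j m; last by move=> mj; apply: nth_default; apply: leq_trans sc _.
have <- : (c * 'X^e)`_(j + e) = c`_j by rewrite coefMXn ltnNge leq_addl addnK.
by apply: h; lia.
Qed.

Lemma dvdp_polyXn (k : fieldType) (n : nat) (P : {poly k}) :
  reflect (forall i, (i < n)%N -> P`_i = 0) ('X^n %| P).
Proof.
apply: (iffP idP) => [/dvdpP[Q ->] i lin | h]; first by rewrite coefMXn lin.
rewrite -[P](poly_take_drop n) dvdp_add ?dvdp_mulIr //.
have -> : take_poly n P = 0; last exact: dvdp0.
by apply/polyP=> i; rewrite coef_take_poly coef0; case: ifP => // /h.
Qed.

Lemma leq_absdiffM (y u v : nat) : u != v -> (y <= absdiff (y * u) (y * v))%N.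
Proof.
rewrite -absdiffMl => uv; rewrite leq_pmulr // /absdiff.
by rewrite addn_gt0 !subn_gt0 orbC -neq_ltn.
Qed.

(** A nonzero [c] gives a syzygy of degree [m + e] with orders [q - e] at 0, [q - e] at infinity and
    [e] at -1. The triple of orders is close to [q (2/3, 2/3, 1/3)], too far from the lattices
    [p^s Z^3] for the gap that [2 * m + 4 < p ^ n] forces. *)
Lemma nondegenerate_cubic (k : fieldType) (p n e m : nat) :
  p \in [pchar k] -> p != 3 ->
  (p ^ n <= 3 * e <= p ^ n + 2)%N -> (2 * m + 4 < p ^ n)%N ->
  nondegenerate ('X^e * ('X + 1) ^+ e : {poly k}) (3 * e) m (p ^ n).
Proof.
move=> pc p3 he hm; have pp := pcharf_prime pc.
have ndvd3 N : ~~ (3 %| p ^ N)%N.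
  by rewrite Euclid_dvdX // dvdn_prime2 // eq_sym (negPf p3).
set q := (p ^ n)%N in he hm *.
move=> c sc h; apply/eqP/negPn/negP => c0.
have y0 : ('X + 1 : {poly k}) = 'X - (-1)%:P by rewrite polyCN opprK.
pose Q := c * ('X + 1) ^+ e.
have X10 : ('X + 1 : {poly k}) ^+ e != 0 by rewrite expf_neq0 // y0 polyXsubC_eq0.
have sX1 : size (('X + 1 : {poly k}) ^+ e) = e.+1 by rewrite y0 size_exp_XsubC.
have Q0 : Q != 0 by rewrite mulf_neq0.
have sQ : size Q = (size c + e)%N by rewrite size_mulf // sX1 addnS.
have hQ i : (i + e < q)%N -> (m + 2 * e < i + q)%N -> Q`_i = 0.
  move=> h1 h2; have <- : ('X^e * Q)`_(i + e) = Q`_i.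
    by rewrite coefXnM ltnNge leq_addl addnK.
  by rewrite /Q mulrCA; apply: h; lia.
(* The vanishing coefficients of [Q] lie just below exponent [q - e]. Cutting there leaves a lower
   part [V] of small degree and an upper part [U] divisible by ['X^(q - e)]. *)
pose V := take_poly (q - e) Q; pose U := drop_poly (q - e) Q * 'X^(q - e).
have eQ : U + V = Q by rewrite addrC poly_take_drop.
have sV : (size V <= m + 2 * e + 1 - q)%N.
  apply/leq_sizeP=> j hj; rewrite coef_take_poly; case: ifP => // hj2.
  by apply: hQ; lia.
have V0 : V != 0.
  apply/eqP=> V0; move: eQ; rewrite V0 addr0 => eU.
  have : 'X^(q - e) %| c.
    rewrite -(@Gauss_dvdpl _ c (('X + 1) ^+ e)) -/Q -?eU ?dvdp_mulIr //.
    rewrite coprimep_expl // coprimep_expr // y0 -{1}['X]subr0 -polyC0.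
    by rewrite coprimep_XsubC2 // subr0 oppr_eq0 oner_eq0.
  by move/(dvdp_leqf c0); rewrite size_polyXn; lia.
have U0 : U != 0.
  apply/eqP=> U0; move: eQ sV; rewrite U0 add0r => ->; rewrite sQ.
  by move: (c0); rewrite -size_poly_gt0; lia.
have xy : (0 : k) != -1 by rewrite eq_sym oppr_eq0 oner_eq0.
have yp : (-1 : k) ^+ p = -1.
  by rewrite -(pFrobenius_autE pc) pFrobenius_autN pFrobenius_aut1.
have xp : (0 : k) ^+ p = 0 by rewrite expr0n gtn_eqF ?prime_gt0.
have [|||||s [a' [b' [c' [H le_s]]]]] := mason_descent (D := m + e) (a := q - e)
  (b := q - e) (c := e) pc xp yp xy U0 V0.
- by rewrite eQ.
- have -> : U = Q - V by rewrite -eQ addrK.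
  apply: leq_trans (size_polyD _ _) _; rewrite size_polyN sQ geq_max.
  by rewrite -addSn leq_add2r sc; apply: leq_trans sV _; lia.
- by move: V0 sV; rewrite -size_poly_gt0; lia.
- by rewrite subr0 dvdp_mulIr.
- by rewrite eQ -y0 dvdp_mulIr.
(* As 3 does not divide [q], each coordinate of [q (2/3, 2/3, 1/3)] is at distance
   at least [p^s / 3] from the multiples of [p^s]. *)
have s_n : (s <= n)%N.
  rewrite leqNgt; apply/negP => lt_ns.
  have : (q <= p ^ s)%N by rewrite leq_exp2l ?prime_gt1 // ltnW.
  by move: le_s; lia.
have eq_ : q = (p ^ s * p ^ (n - s))%N by rewrite -expnD subnKC.
have mult3 u v : ~~ (3 %| u)%N -> (p ^ s <= absdiff (p ^ s * u) (3 * (p ^ s * v)))%N.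
  move=> hu; rewrite mulnCA; apply: leq_absdiffM.
  by apply: contraNneq hu => ->; rewrite dvdn_mulr.
have A1 v := mult3 (2 * p ^ (n - s))%N v.
have A2 v := mult3 (p ^ (n - s))%N v (ndvd3 _).
have h2 : ~~ (3 %| 2 * p ^ (n - s))%N by rewrite Euclid_dvdM // negb_or ndvd3.
move: (A1 a' h2) (A1 b' h2) (A2 c') H; rewrite mulnCA -eq_ /absdiff; move: he hm; clear.
move: (p ^ s)%N => y; move: (y * a')%N (y * b')%N (y * c')%N q => xa xb xc q.
by lia.
Qed.

(* A truncation of the root [phi] of [phi = phi^3 + t^2] in characteristic 3. *)
Definition artin_schreier (k : fieldType) (n : nat) : {poly k} :=
  \sum_(j < n) 'X^(2 * 3 ^ j).

Lemma artin_schreierS (k : fieldType) (n : nat) :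
  artin_schreier k n.+1 = 'X^2 + (artin_schreier k n \Po 'X^3).
Proof.
rewrite /artin_schreier big_ord_recl expn0 muln1; congr (_ + _).
rewrite rmorph_sum /=; apply: eq_bigr => j _.
by rewrite comp_Xn_poly -exprM mulnCA expnS.
Qed.

Lemma dvdp_Xn_split (k : fieldType) (a b : nat) (M T : {poly k}) :
  (a <= b)%N -> M`_0 != 0 -> 'X^b %| 'X^a * M * T -> 'X^(b - a) %| T.
Proof.
move=> ab M0; rewrite -{1}(subnKC ab) exprD -mulrA dvdp_mul2l ?expf_neq0 ?polyX_eq0 //.
rewrite Gauss_dvdpr // coprimep_expl // coprimep_sym coprimepX.
by rewrite /root horner_coef0.
Qed.

(** Too good an approximation [r / c] at level [n.+1] descends through ['X |-> 'X^3] to one at level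
    [n]; at level 0 the bound on [c] is already impossible. *)
Lemma artin_schreier_approx (k : fieldType) : 3 \in [pchar k] ->
  forall (n : nat) (c r : {poly k}), c != 0 ->
  (2 * (size c).-1 + 1 < 3 ^ n)%N -> (2 * (size r).-1 < 3 ^ n)%N ->
  ~ 'X^(3 ^ n) %| c * artin_schreier k n - r.
Proof.
move=> pc; elim=> [|n IH] c r c0 hc hr; first by move: hc; rewrite expn0 addn1.
rewrite artin_schreierS; set F := artin_schreier k n; set z := _ - r => dz.
have c_gt0 : (0 < size c)%N by rewrite size_poly_gt0.
have three0 : 3%:R = 0 :> {poly k}.
  by rewrite -polyC_natr (pcharf0 pc).
have dF : (F \Po 'X^3)^`() = 0.
  by rewrite deriv_comp derivXn -[_ *+ 3]mulr_natl three0 mul0r mulr0.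
have dz' : 'X^(3 ^ n.+1) %| z^`().
  have /dvdpP[s ->] := dz; rewrite derivM derivXn expnS mulrnA.
  have -> : 'X^((3 * 3 ^ n).-1) *+ 3 = 0 :> {poly k} by rewrite -mulr_natl three0 mul0r.
  by rewrite mul0rn mulr0 addr0 dvdp_mulIr.
(* By [artin_schreierS], [rho / c] approximates [F \Po 'X^3], whose derivative is zero, so the
   Wronskian of [c] and [rho] should vanish. *)
pose rho := r - 'X^2 * c.
have W : c * rho^`() = c^`() * rho.
  apply/eqP; rewrite -subr_eq0.
  (* Written with [z], the Wronskian is divisible by ['X^(3 ^ n.+1)]; written with [r] and [c], its
     degree is smaller than that. The term [c * c * 'X] is the origin of the [+ 1] in the bound on
     [c]. *)
  have eW : c * rho^`() - c^`() * rho = - (c * z^`() - c^`() * z).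
    by rewrite /rho /z !(derivN, derivD, derivM) dF; ring.
  have eW2 : c * rho^`() - c^`() * rho = c * r^`() - c^`() * r - (c * c * 'X) *+ 2.
    by rewrite /rho !(derivN, derivD, derivM) derivX; ring.
  apply/negPn/negP => W0; have := W0; rewrite {1}eW oppr_eq0 => W1.
  have /(dvdp_leqf W1) : 'X^(3 ^ n.+1) %| c * z^`() - c^`() * z.
    by rewrite dvdp_sub ?dvdp_mull.
  rewrite -(size_polyN (_ - _)) -eW eW2 size_polyXn; apply/negP; rewrite -leqNgt.
  apply: leq_trans (size_polyD _ _) _; rewrite size_polyN geq_max; apply/andP; split.
    apply: leq_trans (size_polyD _ _) _; rewrite size_polyN geq_max; apply/andP; split.
      have [->|r0] := eqVneq r 0; first by rewrite deriv0 mulr0 size_poly0.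
      apply: leq_trans (size_mul_leqf _ _) _.
      by have := lt_size_derivf r0; lia.
    apply: leq_trans (size_mul_leqf _ _) _.
    by have := lt_size_derivf c0; lia.
  rewrite mulr2n; apply: leq_trans (size_polyD _ _) _; rewrite maxnn.
  by rewrite size_mulX ?mulf_neq0 // size_mulf //; lia.
have [M [c1 [r1 [ec er]]]] := wronskian_eq0 pc c0 W.
have M0 : M != 0 by apply: contraNneq c0 => M0; rewrite ec M0 mul0r.
have [al [M1 M10 eM]] := multiplicity_XsubC M 0.
rewrite M0 /= in M10; rewrite subr0 in eM.
(* Absorbing the powers of ['X^3] that divide [M] into the descended pair keeps its
   order of contact at least [3^n]. *)
pose a1 := (al %/ 3)%N; pose c2 : {poly k} := 'X^a1 * c1; pose r2 : {poly k} := 'X^a1 * r1.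
pose M2 : {poly k} := 'X^(al %% 3) * M1.
have absorb w : M * (w \Po 'X^3) = M2 * (('X^a1 * w) \Po 'X^3).
  rewrite eM /M2 comp_polyM comp_Xn_poly -exprM {1}(divn_eq al 3) exprD mulnC -/a1; ring.
have ec2 : c = M2 * (c2 \Po 'X^3) by rewrite ec absorb.
have er2 : r = M2 * ((r2 \Po 'X^3) + 'X^2 * (c2 \Po 'X^3)).
  rewrite mulrDr mulrCA -ec2 -absorb -er /rho; ring.
have c20 : c2 != 0 by apply: contraNneq c0 => c20; rewrite ec2 c20 comp_poly0 mulr0.
have M20 : M2 != 0 by apply: contraNneq c0 => e; rewrite ec2 e mul0r.
(* The exponents in the two summands are 0 and 2 modulo 3, so nothing cancels and the degree of [T]
   controls both [r2] and [c2]. *)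
pose T : {poly k} := (r2 \Po 'X^3) + 'X^2 * (c2 \Po 'X^3).
have sT i : T`_i != 0 -> (2 * i < 3 ^ n.+1)%N.
  move=> Ti; have iT : (i < size T)%N by rewrite ltnNge; apply: contraNN Ti => /leq_sizeP->.
  have T0 : T != 0 by rewrite -size_poly_gt0; case: (size T) iT.
  apply: leq_ltn_trans hr; rewrite er2 size_mulf // leq_mul2l /=.
  have arith (a b j : nat) : (0 < a -> j < b -> j <= (a + b).-2)%N by clear; lia.
  by apply: arith iT; rewrite size_poly_gt0.
have T2 i : T`_(3 * i + 2) = c2`_i.
  rewrite coefD coef_comp_poly_Xn // coefXnM coef_comp_poly_Xn //.
  rewrite dvdn_addr ?dvdn_mulr //= add0r.
  by rewrite ltnNge leq_addl /= addnK dvdn_mulr // mulKn.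
have T0 i : T`_(3 * i) = r2`_i.
  rewrite coefD coef_comp_poly_Xn // coefXnM coef_comp_poly_Xn //.
  rewrite dvdn_mulr // mulKn //; case: ifP; first by rewrite addr0.
  case: i => // i _; rewrite ifF ?addr0 //; clear; lia.
apply: (IH c2 r2 c20).
- have := sT (3 * (size c2).-1 + 2)%N; rewrite T2 -/(lead_coef c2) lead_coef_eq0 => /(_ c20).
  by rewrite expnS; clear; lia.
- have [->|r20] := eqVneq r2 0; first by rewrite size_poly0 expn_gt0.
  have := sT (3 * (size r2).-1)%N; rewrite T0 -/(lead_coef r2) lead_coef_eq0 => /(_ r20).
  by rewrite expnS; clear; lia.
have ez : z = M2 * ((c2 * F - r2) \Po 'X^3).
  by rewrite /z {1}ec2 {1}er2 comp_polyB (comp_polyM c2 F); ring.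
have : 'X^(3 ^ n.+1 - al %% 3) %| (c2 * F - r2) \Po 'X^3.
  apply: (@dvdp_Xn_split _ _ _ M1); last by rewrite -/M2 -ez.
    by apply: leq_trans (ltnW (ltn_pmod _ _)) _; rewrite // expnS leq_pmulr // expn_gt0.
  by move: M10; rewrite /root horner_coef0.
(* At most 2 orders of contact are lost, and [3 * i <= 3 ^ n.+1 - 3] for [i < 3 ^ n], so no
   coefficient of the descended series is missed. *)
move/dvdp_polyXn => h; apply/dvdp_polyXn => i hi.
have := h (3 * i)%N; rewrite coef_comp_poly_Xn // dvdn_mulr // mulKn //; apply.
by move: hi (ltn_pmod al (isT : 0 < 3)%N); rewrite expnS; clear; lia.
Qed.

(** The vanishing coefficients are those strictly between [m + 1] and [3 ^ n]: modulo ['X^(3 ^ n)]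
    the product is a polynomial of degree at most [m + 1], which [artin_schreier_approx] forbids. *)
Lemma nondegenerate_artin_schreier (k : fieldType) (n m : nat) :
  3 \in [pchar k] -> (2 * m + 2 < 3 ^ n)%N ->
  nondegenerate (artin_schreier k n) (3 ^ n + 1) m (3 ^ n).
Proof.
move=> pc hm c sc h; apply/eqP/negPn/negP => c0.
pose r := take_poly (3 ^ n) (c * artin_schreier k n).
have sr : (size r <= m.+2)%N.
  apply/leq_sizeP => j hj; rewrite coef_take_poly; case: ifP => // hj2.
  by apply: h => //; lia.
apply: (@artin_schreier_approx _ pc n c r c0).
- by lia.
- by lia.
by rewrite -{1}[c * _](poly_take_drop (3 ^ n)) -/r [r + _]addrC addrK dvdp_mulIr.
Qed.

(** * Dimension modulo a subspace *)

Definition subspace (k : fieldType) (A : lmodType k) (I : set A) : Prop :=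
  I 0 /\ forall (c : k) x y, I x -> I y -> I (c *: x + y).

Definition free_mod (k : fieldType) (A : lmodType k) (I : set A) (T : finType)
    (b : T -> A) : Prop :=
  forall c : T -> k, I (\sum_t c t *: b t) -> forall t, c t = 0.

(** Stated for one vector, so that the vectors spanned form a subspace and spanning can be checked
    on monomials. *)
Definition spans_mod (k : fieldType) (A : lmodType k) (I : set A) (T : finType)
    (b : T -> A) (a : A) : Prop :=
  exists c : T -> k, I (a - \sum_t c t *: b t).

Lemma subspaceD (k : fieldType) (A : lmodType k) (I : set A) x y :
  subspace I -> I x -> I y -> I (x + y).
Proof. by case=> _ h Ix Iy; rewrite -[x]scale1r; apply: h. Qed.

Lemma subspaceZ (k : fieldType) (A : lmodType k) (I : set A) c x :
  subspace I -> I x -> I (c *: x).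
Proof. by case=> I0 h Ix; rewrite -[c *: x]addr0; apply: h. Qed.

Lemma subspaceB (k : fieldType) (A : lmodType k) (I : set A) x y :
  subspace I -> I x -> I y -> I (x - y).
Proof. by move=> sI Ix Iy; apply: subspaceD => //; rewrite -scaleN1r; apply: subspaceZ. Qed.

Lemma subspace_sum (k : fieldType) (A : lmodType k) (I : set A) (T : finType)
    (P : pred T) (F : T -> A) :
  subspace I -> (forall t, P t -> I (F t)) -> I (\sum_(t | P t) F t).
Proof.
move=> sI h; elim/big_ind : _ => //; first by case: sI.
by move=> x y; apply: subspaceD.
Qed.

Lemma sum_enum_val (V : nmodType) (S : finType) (F : S -> V) :
  \sum_x F x = \sum_(i < #|S|) F (enum_val i).
Proof. by rewrite -(big_enum_val (A := S)). Qed.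

Lemma sum_enum_rank (V : nmodType) (S : finType) (F : 'I_#|S| -> V) :
  \sum_i F i = \sum_x F (enum_rank x).
Proof. by rewrite [RHS]sum_enum_val; under [RHS]eq_bigr do rewrite enum_valK. Qed.

(** A row vector killing the matrix of coefficients of [b] in [s] is a relation among the [b i]
    modulo [I]. Freeness thus makes the matrix row free, with at least as many columns as rows. *)
Lemma free_mod_le (k : fieldType) (A : lmodType k) (I : set A) (S T : finType)
    (b : S -> A) (s : T -> A) :
  subspace I -> free_mod I b -> (forall i, spans_mod I s (b i)) -> (#|S| <= #|T|)%N.
Proof.
move=> sI fb /choice[C hC].
pose M := \matrix_(i < #|S|, j < #|T|) C (enum_val i) (enum_val j).
suff /eqP <- : row_free M by exact: rank_leq_col.
rewrite -kermx_eq0; apply/rowV0P => v /sub_kermxP vM.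
pose c (x : S) := v 0 (enum_rank x).
suff c0 : forall x, c x = 0.
  by apply/rowP=> i; rewrite mxE -(c0 (enum_val i)) /c enum_valK.
apply: fb.
have -> : \sum_x c x *: b x = \sum_x c x *: (b x - \sum_t C x t *: s t).
  apply/eqP; rewrite -subr_eq0 -sumrB; apply/eqP.
  under eq_bigr => x _ do rewrite scalerBr opprB addrC subrK scaler_sumr.
  rewrite exchange_big big1 // => t _.
  under eq_bigr => x _ do rewrite scalerA.
  rewrite -scaler_suml; suff -> : \sum_x c x * C x t = 0 by rewrite scale0r.
  have /rowP/(_ (enum_rank t)) := vM; rewrite !mxE => vMt.
  rewrite -[RHS]vMt [LHS]sum_enum_val; apply: eq_bigr => i _.
  by rewrite mxE /c enum_valK enum_rankK.
by apply: subspace_sum => // x _; apply: subspaceZ.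
Qed.

(** [quot_dim] is either the size of a basis or the default 0, for which the bound is trivial. *)
Lemma quot_dim_le (k : fieldType) (A : lmodType k) (I : set A) (T : finType)
    (s : T -> A) :
  subspace I -> (forall a, spans_mod I s a) -> (quot_dim I <= #|T|)%N.
Proof.
move=> sI ss; rewrite /quot_dim; case: xgetP => [m _ [b [fb _]]|//].
by rewrite -[m]card_ord; apply: free_mod_le fb _.
Qed.

(** A spanning family of least size is free: a relation with a nonzero coefficient would eliminate
    one of its vectors. *)
Lemma quot_dim_basis (k : fieldType) (A : lmodType k) (I : set A) (T : finType)
    (s : T -> A) :
  subspace I -> (forall a, spans_mod I s a) ->
  exists b : 'I_(quot_dim I) -> A, basis_mod I b.
Proof.
move=> sI ss.
pose Q m := `[< exists b : 'I_m -> A, forall a, spans_mod I b a >].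
have exQ : exists m, Q m.
  exists #|T|; apply/asboolP; exists (s \o enum_val) => a.
  have [c hc] := ss a; exists (c \o enum_val).
  by move: hc; rewrite sum_enum_val.
case: (ex_minnP exQ) => m /asboolP[b bs] minm.
suff exb : exists m, exists b : 'I_m -> A, basis_mod I b.
  rewrite /quot_dim; case: xgetP => [m1 _ //|h].
  by have [m' h'] := exb; case: (h m').
exists m, b; split=> // c Ic i; apply/eqP/negPn/negP => ci.
case: m b bs minm c Ic i ci => [|m] b bs minm c Ic i ci; first by case: i ci.
suff /minm : Q m by rewrite ltnn.
apply/asboolP; exists (b \o lift i) => a; have [e he] := bs a.
exists (fun j => e (lift i j) - e i / c i * c (lift i j)).
have := subspaceD sI he (subspaceZ (e i / c i) sI Ic).
rewrite !(bigD1_ord i) //= scalerDr scalerA divfK //.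
rewrite opprD (addrA a) addrACA subrK [- _ + _]addrC -opprB.
rewrite scaler_sumr -sumrB.
congr (I (_ - _)); apply: eq_bigr => j _.
by rewrite scalerBl scalerA.
Qed.

Definition mx_of (k : fieldType) (T : finType) (N : T -> T -> k) : 'M[k]_#|T| :=
  \matrix_(i, j) N (enum_val i) (enum_val j).

(** In each slice [d] the combinations with coefficients in the row space of [N] lie in [I], so a
    basis of a complement of that row space suffices for spanning. *)
Lemma spans_mod_complement (k : fieldType) (A : lmodType k) (I : set A)
    (D T : finType) (e : D * T -> A) (N : T -> T -> k) (a : A) :
  subspace I ->
  (forall d i, I (\sum_j N i j *: e (d, j))) -> spans_mod I e a ->
  let B := row_base (mx_of N)^C%MS in
  spans_mod I (fun x => \sum_t B x.2 (enum_rank t) *: e (x.1, t)) a.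
Proof.
move=> sI hN [c hc] B; set M := mx_of N.
pose v (d : D) : 'rV[k]_#|T| := \row_i c (d, enum_val i).
have dec (d : D) : exists yz : 'rV[k]_#|T| * 'rV[k]_(\rank (mx_of N)^C)%MS,
    v d = yz.1 *m M + yz.2 *m B.
  have : (v d <= M + M^C)%MS.
    by rewrite submx_full // addsmx_compl_full.
  case/sub_addsmxP=> [[y z] /= ->].
  have /submxP[z' ez] : (z *m M^C <= B)%MS.
    by rewrite eq_row_base submxMl.
  by exists (y, z'); rewrite /= ez.
have [yz hyz] := choice dec.
exists (fun x => (yz x.1).2 0 x.2).
have eN : \sum_x c x *: e x =
    \sum_d \sum_i (yz d).1 0 (enum_rank i) *: (\sum_j N i j *: e (d, j))
  + \sum_x (yz x.1).2 0 x.2 *: (\sum_t B x.2 (enum_rank t) *: e (x.1, t)).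
  rewrite (eq_bigr (fun x => c (x.1, x.2) *: e (x.1, x.2))); last by case.
  rewrite -(pair_bigA _ (fun d t => c (d, t) *: e (d, t))) /=.
  rewrite -(pair_bigA _ (fun d j => (yz d).2 0 j *:
     (\sum_t B j (enum_rank t) *: e (d, t)))) /= -big_split /=.
  apply: eq_bigr => d _.
  have ec t : c (d, t) = \sum_i (yz d).1 0 (enum_rank i) * N i t
                        + \sum_j (yz d).2 0 j * B j (enum_rank t).
    have /rowP/(_ (enum_rank t)) := hyz d; rewrite !mxE enum_rankK => ->.
    rewrite sum_enum_rank; congr (_ + _); apply: eq_bigr => i _.
    by rewrite mxE !enum_rankK.
  under eq_bigr do rewrite ec scalerDl !scaler_suml.
  rewrite big_split /= exchange_big /=; congr (_ + _).
    apply: eq_bigr => i _; rewrite scaler_sumr; apply: eq_bigr => t _.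
    by rewrite scalerA.
  rewrite exchange_big /=; apply: eq_bigr => j _.
  by rewrite scaler_sumr; apply: eq_bigr => t _; rewrite scalerA.
move: hc; rewrite eN opprD addrA addrAC.
set w := \sum_d _; move=> hc; rewrite -[X in I X](subrK w); apply: subspaceD => //.
by apply: subspace_sum => // d _; apply: subspace_sum => // i _; apply: subspaceZ.
Qed.

(* The rows in [L] have rank [#|L|], by symmetry so do the columns in [rho L], and
   the zero block where they meet makes the two contributions add up. *)
Lemma mxrank_reversal (k : fieldType) (T : finType) (N : T -> T -> k)
    (L : {set T}) (rho : T -> T) :
  involutive rho -> (forall i j, N i j = N (rho j) (rho i)) ->
  (forall i j, i \in L -> j \in L -> N i (rho j) = 0) ->
  (forall v : T -> k, (forall j, \sum_(i in L) v i * N i j = 0) ->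
     forall i, i \in L -> v i = 0) ->
  (2 * #|L| <= \rank (mx_of N))%N.
Proof.
move=> rhoK Nrho NL freeN; set M := mx_of N.
pose ML : 'M_(#|L|, #|T|) := \matrix_(i, j) N (enum_val i) (enum_val j).
(* Multiplication by [P] on the right selects the columns indexed by [rho L]. *)
pose P : 'M[k]_(#|T|, #|L|) := \matrix_(j, i) (enum_val j == rho (enum_val i))%:R.
have MPE i l : (M *m P) i l = N (enum_val i) (rho (enum_val l)).
  rewrite mxE (bigD1 (enum_rank (rho (enum_val l)))) //= big1 ?addr0.
    by rewrite !mxE enum_rankK eqxx mulr1.
  move=> j jn; rewrite !mxE; case: eqP => [ej|]; last by rewrite mulr0.
  by move: jn; rewrite -ej enum_valK eqxx.
pose vec (v : 'rV[k]_#|L|) (x : T) := \sum_(i < #|L| | enum_val i == x) v 0 i.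
have vecE v i : vec v (enum_val i) = v 0 i.
  rewrite /vec (big_pred1 i) // => j /=; exact: (inj_eq enum_val_inj).
have row_free_of (v : 'rV[k]_#|L|) :
    (forall j, \sum_i v 0 i * N (enum_val i) j = 0) -> v = 0.
  move=> h; apply/rowP=> i; rewrite mxE -vecE; apply: freeN (enum_valP i) => j.
  by rewrite big_enum_val -[RHS](h j); apply: eq_bigr => l _; rewrite vecE.
have rML : \rank ML = #|L|.
  apply/eqP; change (row_free ML); rewrite -kermx_eq0; apply/rowV0P => v /sub_kermxP vM.
  apply: row_free_of => j; have /rowP/(_ (enum_rank j)) := vM; rewrite !mxE => vMj.
  rewrite -[RHS]vMj.
  by apply: eq_bigr => i _; rewrite mxE enum_rankK.
have rMP : \rank (M *m P) = #|L|.
  rewrite -mxrank_tr; apply/eqP; change (row_free (M *m P)^T).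
  rewrite -kermx_eq0; apply/rowV0P => v /sub_kermxP vM.
  apply: row_free_of => j; have /rowP/(_ (enum_rank (rho j))) := vM; rewrite !mxE => vMj.
  rewrite -[RHS]vMj.
  by apply: eq_bigr => i _; rewrite mxE MPE enum_rankK -Nrho.
(* The rank of [M] is that of [M *m P] plus that of the part of its row space killed by [P]. The
   zero block puts the rows of [ML] in that part. *)
rewrite -(mxrank_mul_ker M P) rMP mul2n -addnn leq_add2l -{1}rML mxrankS //.
rewrite sub_capmx; apply/andP; split.
  apply/row_subP => i; suff -> : row i ML = row (enum_rank (enum_val i)) M by exact: row_sub.
  by apply/rowP=> j; rewrite !mxE enum_rankK.
apply/sub_kermxP/matrixP => i l; rewrite [RHS]mxE.
rewrite -(NL _ _ (enum_valP i) (enum_valP l)) -(enum_rankK (enum_val i)) -MPE !mxE.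
by apply: eq_bigr => j _; rewrite !mxE enum_rankK.
Qed.

Lemma quot_dim_le_mxrank (k : fieldType) (A : lmodType k) (I : set A)
    (D T : finType) (e : D * T -> A) (N : T -> T -> k) :
  subspace I -> (forall a, spans_mod I e a) ->
  (forall d i, I (\sum_j N i j *: e (d, j))) ->
  (quot_dim I <= #|D| * (#|T| - \rank (mx_of N)))%N.
Proof.
move=> sI se hN; rewrite -mxrank_compl -[X in (_ * X)%N]card_ord -card_prod.
exact: quot_dim_le sI (fun a => spans_mod_complement sI hN (se a)).
Qed.

Lemma subspace_spans_mod (k : fieldType) (A : lmodType k) (I : set A)
    (T : finType) (b : T -> A) :
  subspace I -> subspace (spans_mod I b).
Proof.
move=> sI; split.
  exists (fun=> 0); rewrite big1 ?subr0; first by case: sI.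
  by move=> t _; rewrite scale0r.
move=> c x y [cx Ix] [cy Iy]; exists (fun t => c * cx t + cy t).
have -> : c *: x + y - \sum_t (c * cx t + cy t) *: b t =
   c *: (x - \sum_t cx t *: b t) + (y - \sum_t cy t *: b t).
  rewrite scalerBr addrACA -opprD scaler_sumr -big_split /=; congr (_ - _).
  by apply: eq_bigr => t _; rewrite scalerDl scalerA.
by case: sI => _; apply.
Qed.

Lemma spans_mod_ideal (k : fieldType) (A : lmodType k) (I : set A)
    (T : finType) (b : T -> A) a :
  I a -> spans_mod I b a.
Proof.
by exists (fun=> 0); rewrite big1 ?subr0 // => t _; rewrite scale0r.
Qed.

Lemma spans_mod_gen (k : fieldType) (A : lmodType k) (I : set A)
    (T : finType) (b : T -> A) t :
  subspace I -> spans_mod I b (b t).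
Proof.
case=> I0 _; exists (fun t' => (t' == t)%:R).
rewrite (bigD1 t) //= eqxx scale1r big1 ?addr0 ?subrr //.
by move=> t' /negPf->; rewrite scale0r.
Qed.

(** * Hilbert-Kunz functions of plane curves *)

Lemma ideal_gen_ind (A : comNzRingType) (gs : seq A) (P : A -> Prop) (a : A) :
  P 0 -> (forall x y, P x -> P y -> P (x + y)) ->
  (forall c g, g \in gs -> P (c * g)) -> ideal_gen gs a -> P a.
Proof.
move=> P0 PD Pg [c ->]; elim/big_ind: _ => // i _.
by apply: Pg; rewrite mem_nth.
Qed.

Lemma ideal_gen_mem (A : comNzRingType) (gs : seq A) (c g : A) :
  g \in gs -> ideal_gen gs (c * g).
Proof.
move=> ggs; have lt := ggs; rewrite -index_mem in lt.
exists (fun i => if i == Ordinal lt then c else 0).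
rewrite (bigD1 (Ordinal lt)) //= eqxx nth_index // big1 ?addr0 //.
by move=> i /negPf->; rewrite mul0r.
Qed.

Lemma ideal_genD (A : comNzRingType) (gs : seq A) (a b : A) :
  ideal_gen gs a -> ideal_gen gs b -> ideal_gen gs (a + b).
Proof.
move=> [c ->] [c' ->]; exists (fun i => c i + c' i).
by rewrite -big_split; apply: eq_bigr => i _; rewrite mulrDl.
Qed.

Lemma ideal_genM (A : comNzRingType) (gs : seq A) (a b : A) :
  ideal_gen gs b -> ideal_gen gs (a * b).
Proof.
move=> [c ->]; exists (fun i => a * c i).
by rewrite mulr_sumr; apply: eq_bigr => i _; rewrite mulrA.
Qed.

Lemma subspace_HK_ideal (k : fieldType) (q : nat) (f : {mpoly k[3]}) : subspace (HK_ideal f q).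
Proof.
split.
  by rewrite -(mul0r f); apply: ideal_gen_mem; rewrite mem_head.
move=> c x y hx hy; apply: ideal_genD => //.
by rewrite -[x]mul1r scalerAl; apply: ideal_genM.
Qed.

Lemma HK_ideal_curve (k : fieldType) (q : nat) (f h : {mpoly k[3]}) : HK_ideal f q (h * f).
Proof. by apply: ideal_gen_mem; rewrite mem_head. Qed.

Lemma HK_ideal_Xq (k : fieldType) (q : nat) (f h : {mpoly k[3]}) (i : 'I_3) :
  HK_ideal f q (h * 'X_i ^+ q).
Proof.
by apply: ideal_gen_mem; rewrite inE fintype.image_f ?orbT.
Qed.

Lemma HK_ideal_ind (k : fieldType) (q : nat) (f : {mpoly k[3]})
    (P : {mpoly k[3]} -> Prop) (a : {mpoly k[3]}) :
  P 0 -> (forall x y, P x -> P y -> P (x + y)) -> (forall h, P (h * f)) ->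
  (forall h (i : 'I_3), P (h * 'X_i ^+ q)) -> HK_ideal f q a -> P a.
Proof.
move=> P0 PD Pf PX; apply: ideal_gen_ind => // c g; rewrite inE.
by case/orP=> [/eqP->|/fintype.imageP[i _ ->]].
Qed.

Definition mnm3 (a b c : nat) : 'X_{1..3} :=
  (U_(0%R) *+ a + U_(1%R) *+ b + U_(2%:R) *+ c)%MM.

Lemma mdeg_mnm3 a b c : mdeg (mnm3 a b c) = (a + b + c)%N.
Proof. by rewrite /mnm3 !mdegD !mdegMn !mdeg1 !mul1n. Qed.

Lemma mnm3E a b c : (mnm3 a b c 0%R = a) * (mnm3 a b c 1%R = b) * (mnm3 a b c 2%:R = c).
Proof.
by rewrite /mnm3 !mnmDE !mulmnE !mnm1E /= !mul0n !mul1n ?addn0 ?add0n.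
Qed.

Lemma ord3P (P : 'I_3 -> Prop) : P 0 -> P 1 -> P 2%:R -> forall i, P i.
Proof.
move=> P0 P1 P2 [[|[|[|]]] h] //.
- by rewrite (_ : Ordinal h = 0) //; apply: val_inj.
- by rewrite (_ : Ordinal h = 1) //; apply: val_inj.
- by rewrite (_ : Ordinal h = 2%:R) //; apply: val_inj.
Qed.

Lemma mnm3_surj (m : 'X_{1..3}) : m = mnm3 (m 0%R) (m 1%R) (m 2%:R).
Proof. by apply/mnmP; apply: ord3P; rewrite mnm3E. Qed.

Lemma mnm3_inj a b c a' b' c' :
  mnm3 a b c = mnm3 a' b' c' -> [/\ a = a', b = b' & c = c'].
Proof.
move=> e; split.
- by have := congr1 (fun m : 'X_{1..3} => m 0%R) e; rewrite !mnm3E.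
- by have := congr1 (fun m : 'X_{1..3} => m 1%R) e; rewrite !mnm3E.
- by have := congr1 (fun m : 'X_{1..3} => m 2%:R) e; rewrite !mnm3E.
Qed.

Definition mon (k : fieldType) (a b c : nat) : {mpoly k[3]} := 'X_[mnm3 a b c].

Lemma monE (k : fieldType) (a b c : nat) :
  mon k a b c = 'X_0 ^+ a * 'X_1 ^+ b * 'X_(2%:R) ^+ c.
Proof. by rewrite /mon /mnm3 !mpolyXD !mpolyXn. Qed.

Lemma monM (k : fieldType) (a b c a' b' c' : nat) :
  mon k a b c * mon k a' b' c' = mon k (a + a') (b + b') (c + c').
Proof. by rewrite !monE !exprD; ring. Qed.

Lemma subspace_mon (k : fieldType) (P : set {mpoly k[3]}) :
  subspace P -> (forall a b c, P (mon k a b c)) -> forall p, P p.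
Proof.
move=> sP hP p; rewrite (mpolyE p); elim/big_ind: _.
- by case: sP.
- by move=> x y; apply: subspaceD.
- by move=> m _; apply: subspaceZ => //; rewrite (mnm3_surj m); apply: hP.
Qed.

Lemma HK_ideal_mon (k : fieldType) (q : nat) (f : {mpoly k[3]}) (a b c : nat) :
  [|| q <= a, q <= b | q <= c]%N -> HK_ideal f q (mon k a b c).
Proof.
have h (i : 'I_3) (m : 'X_{1..3}) : (q <= m i)%N -> HK_ideal f q 'X_[m].
  move=> qm; have -> : 'X_[m] = 'X_[m - U_(i) *+ q] * 'X_i ^+ q :> {mpoly k[3]}.
    rewrite mpolyXn -mpolyXD submK //; apply/mnm_lepP => j.
    by rewrite mulmnE mnm1E; case: eqP => [<-|_]; rewrite ?mul1n.
  exact: HK_ideal_Xq.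
by case/or3P => hq; [apply: (h 0) | apply: (h 1) | apply: (h 2%:R)]; rewrite mnm3E.
Qed.

Definition box_mon (k : fieldType) (q : nat) (t : 'I_q * 'I_q * 'I_q) :=
  mon k t.1.1 t.1.2 t.2.

Lemma box_spans (k : fieldType) (q : nat) (f : {mpoly k[3]}) a :
  spans_mod (HK_ideal f q) (box_mon k (q := q)) a.
Proof.
have sI := subspace_HK_ideal q f.
apply: (subspace_mon (P := spans_mod _ _)) => [|b c d]; first exact: subspace_spans_mod.
have [h|] := boolP [|| q <= b, q <= c | q <= d]%N.
  exact/spans_mod_ideal/HK_ideal_mon.
rewrite !negb_or -!ltnNge => /and3P[hb hc hd].
exact: (@spans_mod_gen _ _ _ _ (box_mon k (q := q)) (Ordinal hb, Ordinal hc, Ordinal hd) sI).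
Qed.

(** The monomials of the box span the quotient, so [HK] is a genuine dimension and not the default
    value of [quot_dim]. *)
Lemma HK_basis (k : fieldType) (q : nat) (f : {mpoly k[3]}) :
  exists b : 'I_(HK f q) -> {mpoly k[3]}, basis_mod (HK_ideal f q) b.
Proof. exact: quot_dim_basis (subspace_HK_ideal q f) (box_spans q f). Qed.

(** Multiplication by [f] maps the quotient for [g] onto the kernel of the projection from the
    quotient for [f * g] to the quotient for [f]. *)
Lemma HK_mul (k : fieldType) (q : nat) (f g : {mpoly k[3]}) :
  (HK (f * g) q <= HK f q + HK g q)%N.
Proof.
have [b [_ sb]] := HK_basis q f; have [b' [_ sb']] := HK_basis q g.
have sfg := subspace_HK_ideal q (f * g).
have f_lift w : HK_ideal f q w -> exists h, HK_ideal (f * g) q (w - h * f).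
  apply: (HK_ideal_ind (P := fun w => exists h, HK_ideal (f * g) q (w - h * f))).
  - by exists 0; rewrite mul0r subr0; case: sfg.
  - move=> x y [hx Ix] [hy Iy]; exists (hx + hy).
    by rewrite mulrDl opprD addrACA; apply: subspaceD.
  - by move=> h; exists h; rewrite subrr; case: sfg.
  - by move=> h i; exists 0; rewrite mul0r subr0; apply: HK_ideal_Xq.
have g_lift w : HK_ideal g q w -> HK_ideal (f * g) q (w * f).
  apply: (HK_ideal_ind (P := fun w => HK_ideal (f * g) q (w * f))).
  - by rewrite mul0r; case: sfg.
  - by move=> x y; rewrite mulrDl; apply: subspaceD.
  - by move=> h; rewrite mulrAC -mulrA; apply: HK_ideal_curve.
  - by move=> h i; rewrite mulrAC; apply: HK_ideal_Xq.
pose s (x : 'I_(HK f q) + 'I_(HK g q)) := match x with inl i => b i | inr j => b' j * f end.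
rewrite -[HK f q]card_ord -[HK g q]card_ord -card_sum.
apply: (quot_dim_le (s := s) sfg) => a; have [c /f_lift[h]] := sb a.
have [c' /g_lift] := sb' h => Ih Ia.
exists (fun x => match x with inl i => c i | inr j => c' j end).
rewrite big_sumType /= opprD addrA.
have e : (\sum_i c' i *: b' i) * f = \sum_i c' i *: (b' i * f).
  by rewrite mulr_suml; apply: eq_bigr => j _; rewrite scalerAl.
by have := subspaceD sfg Ia Ih; rewrite mulrBl addrA subrK e.
Qed.

(** * The lower bound: counting monomials of the box *)

Lemma mcoeffMX_out (k : fieldType) (p : {mpoly k[3]}) (m m' : 'X_{1..3}) :
  ~~ (m <= m')%MM -> (p * 'X_[m])@_m' = 0.
Proof.
move=> nle; apply/eqP; rewrite mcoeff_eq0 (perm_mem (msuppMX _ _)).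
by apply: contraNN nle => /mapP[m1 _ ->]; rewrite lem_addr.
Qed.

Lemma box_inj (q : nat) (t u : 'I_q * 'I_q * 'I_q) :
  t.1.1 = u.1.1 :> nat -> t.1.2 = u.1.2 :> nat -> t.2 = u.2 :> nat -> t = u.
Proof.
by case: t u => [[? ?] ?] [[? ?] ?] /= /val_inj-> /val_inj-> /val_inj->.
Qed.

(** In degrees at most [M] the box monomials are independent, and they are spanned by a basis of the
    quotient together with the multiples of [f] by box monomials of degree at most [M - d]. *)
Lemma HK_lower (k : fieldType) (q d M : nat) (f : {mpoly k[3]}) :
  f \is d.-homog ->
  (#|[pred t : 'I_q * 'I_q * 'I_q | t.1.1 + t.1.2 + t.2 <= M]| <=
   HK f q + #|[pred t : 'I_q * 'I_q * 'I_q | t.1.1 + t.1.2 + t.2 + d <= M]|)%N.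
Proof.
move=> hf; have [b [_ sb]] := HK_basis q f.
(* Working modulo [K] keeps exactly the box monomials of degree at most [M]. *)
pose K : set {mpoly k[3]} := fun a => forall m : 'X_{1..3},
  (forall i, m i < q)%N -> (mdeg m <= M)%N -> a@_m = 0.
have sK : subspace K.
  split=> [m _ _|c x y Kx Ky m h1 h2]; first by rewrite mcoeff0.
  by rewrite mcoeffD mcoeffZ Kx // Ky // mulr0 addr0.
pose S := {t : 'I_q * 'I_q * 'I_q | (t.1.1 + t.1.2 + t.2 <= M)%N}.
pose S' := {t : 'I_q * 'I_q * 'I_q | (t.1.1 + t.1.2 + t.2 + d <= M)%N}.
rewrite -(card_sig (fun t : 'I_q * 'I_q * 'I_q => t.1.1 + t.1.2 + t.2 <= M)%N) -/S.
rewrite -(card_sig (fun t : 'I_q * 'I_q * 'I_q => t.1.1 + t.1.2 + t.2 + d <= M)%N) -/S'.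
rewrite -[X in (X + _)%N]card_ord -card_sum.
pose s (x : 'I_(HK f q) + S') :=
  match x with inl i => b i | inr t => f * box_mon k (val t) end.
apply: (free_mod_le (I := K) (b := fun t : S => box_mon k (val t)) (s := s) sK).
  move=> c Kc t; set t1 := val t.
  have := Kc (mnm3 t1.1.1 t1.1.2 t1.2); rewrite mdeg_mnm3 (valP t) => /(_ _ isT) <-.
    rewrite raddf_sum (bigD1 t) //= mcoeffZ mcoeffX eqxx mulr1 big1 ?addr0 // => u ut.
    rewrite mcoeffZ mcoeffX; case: eqP => [/mnm3_inj[e1 e2 e3]|]; last by rewrite mulr0.
    by case/eqP: ut; apply: val_inj; apply: box_inj e1 e2 e3.
  by apply: ord3P; rewrite mnm3E ltn_ord.
have sS := subspace_spans_mod s sK.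
have hI w : HK_ideal f q w -> spans_mod K s w.
  apply: (HK_ideal_ind (P := spans_mod K s)).
  - by case: sS.
  - by move=> x y; apply: subspaceD.
  - apply: (subspace_mon (P := fun h => spans_mod K s (h * f))).
      split; first by rewrite mul0r; case: sS.
      move=> c x y hx hy; rewrite mulrDl -scalerAl.
      by apply: subspaceD => //; apply: subspaceZ.
    move=> a1 a2 a3; rewrite mulrC.
    have [/and4P[h1 h2 h3 hd]|] := boolP [&& a1 < q, a2 < q, a3 < q & a1 + a2 + a3 + d <= M]%N.
      pose t : 'I_q * 'I_q * 'I_q := (Ordinal h1, Ordinal h2, Ordinal h3).
      exact: (@spans_mod_gen _ _ _ _ s (inr (exist _ t hd : S')) sK).
    move=> out; apply: spans_mod_ideal => m mq mM.
    have [le_m|] := boolP (mnm3 a1 a2 a3 <= m)%MM; last exact: mcoeffMX_out.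
    have hM : f * mon k a1 a2 a3 \is (d + (a1 + a2 + a3)).-homog.
      by apply: dhomogM => //; rewrite /mon dhomogX /= mdeg_mnm3.
    apply: (dhomog_nemf_coeff hM); apply: contraNneq out => hd; move/mnm_lepP: le_m => le_m.
    have := le_m 0; have := le_m 1; have := le_m 2%:R; rewrite !mnm3E => l2 l1 l0.
    rewrite (leq_ltn_trans l0) // (leq_ltn_trans l1) // (leq_ltn_trans l2) //=.
    by rewrite addnC -hd.
  - move=> h i; apply: spans_mod_ideal => m mq mM; rewrite mpolyXn mcoeffMX_out //.
    apply/negP=> /mnm_lepP/(_ i); rewrite mulmnE mnm1E eqxx mul1n.
    by rewrite leqNgt mq.
move=> t; have [c /hI Ic] := sb (box_mon k (val t)).
rewrite -[X in spans_mod _ _ X](subrK (\sum_i c i *: b i)); apply: subspaceD => //.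
apply: subspace_sum => // i _; apply: subspaceZ => //.
exact: (@spans_mod_gen _ _ _ _ s (inl i) sK).
Qed.

Definition small_sums (q m : nat) : {set 'I_q * 'I_q} :=
  [set x : 'I_q * 'I_q | (x.1 + x.2 <= m)%N]%SET.

(** Two copies of the triangle, one of them reflected by [t |-> s + 1 - t], fit disjointly in a
    square of side [s + 2]: the coordinate sums are at most [s] in one and at least [s + 2] in the
    other. *)
Lemma card_small_sum_le (q s : nat) :
  (2 * #|[pred x : 'I_q * 'I_q | x.1 + x.2 <= s]| <= s.+2 * s.+2)%N.
Proof.
rewrite -(card_sig (fun x : 'I_q * 'I_q => x.1 + x.2 <= s)%N) -card_bool -card_prod.
rewrite -[s.+2 in X in (_ <= X)%N]card_ord -card_prod.
pose g (y : bool * {x : 'I_q * 'I_q | (x.1 + x.2 <= s)%N}) : 'I_s.+2 * 'I_s.+2 :=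
  let x := val y.2 in
  if y.1 then (inord x.1, inord x.2) else (inord (s.+1 - x.1), inord (s.+1 - x.2)).
apply: (leq_card g) => -[b1 [[i1 j1] /= h1]] [b2 [[i2 j2] /= h2]] e.
have [e1 e2] : nat_of_ord (g (b1, exist _ (i1, j1) h1)).1 = (g (b2, exist _ (i2, j2) h2)).1
  /\ nat_of_ord (g (b1, exist _ (i1, j1) h1)).2 = (g (b2, exist _ (i2, j2) h2)).2.
  by rewrite e.
suff [eb [ei ej]] : b1 = b2 /\ i1 = i2 :> nat /\ j1 = j2 :> nat.
  move: h1 h2 {e e1 e2}; rewrite eb (val_inj ei) (val_inj ej) => h1 h2.
  by congr (_, exist _ _ _); apply: bool_irrelevance.
move: e1 e2; rewrite /g /=; case: b1 {e}; case: b2 => /=; rewrite !inordK; lia.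
Qed.

(** The points of a square of side [m + 1] whose sum exceeds [m] are folded back by [t |-> m - t]
    into a second copy of the triangle. *)
Lemma card_small_sum_ge (q m : nat) : (m < q)%N ->
  (m.+1 * m.+1 <= 2 * #|small_sums q m|)%N.
Proof.
case: q => // q mq.
pose g (x : 'I_m.+1 * 'I_m.+1) : bool * ('I_q.+1 * 'I_q.+1) :=
  if (x.1 + x.2 <= m)%N then (true, (inord x.1, inord x.2))
  else (false, (inord (m - x.1), inord (m - x.2))).
have g_inj : injective g.
  move=> [i1 j1] [i2 j2] e.
  have := congr1 (fun z => (z.1, nat_of_ord z.2.1, nat_of_ord z.2.2)) e.
  have := ltn_ord i1; have := ltn_ord i2; have := ltn_ord j1; have := ltn_ord j2.
  move=> l1 l2 l3 l4; rewrite /g /=.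
  case: leqP => h1; case: leqP => h2 //=; rewrite !inordK; try lia; case=> e1 e2;
  by congr (_, _); apply: val_inj => /=; move: e1 e2 l1 l2 l3 l4; clear; lia.
rewrite -{1 2}[m.+1]card_ord -card_prod -card_bool -(cardsT bool) -cardsX.
rewrite -(card_imset _ g_inj).
apply/subset_leq_card/fintype.subsetP => y /imsetP[[i j] _ ->]; rewrite !inE /= /g /=.
have := ltn_ord i; have := ltn_ord j.
by case: (leqP (i + j)%N m) => h /= l1 l2; rewrite !inordK; move: h l1 l2 mq; clear; lia.
Qed.

(** The difference of the two counts in [HK_lower] is the number of box monomials in the [d] top
    degrees up to [M]. [M] is near [3q/2], about the middle degree of the box, where there are most
    of them. *)
Lemma HK_ge (k : fieldType) (q d : nat) (f : {mpoly k[3]}) :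
  (0 < d)%N -> f \is d.-homog ->
  (d * (q * q - (q./2 + d + 2) * (q./2 + d + 2)) <= HK f q)%N.
Proof.
case: q => [|q] d_gt0 hf; first by rewrite mul0n sub0n muln0.
set M := (q.+1 + q.+1./2)%N.
have := HK_lower q.+1 M hf.
set A := [pred t | _]; set B := [pred t | _] => hAB.
(* The pairs of exponents of [x] and [y] that an exponent of [z] inside the box completes to each of
   the degrees [M - j], [j < d]. *)
pose Z := [pred x : 'I_q.+1 * 'I_q.+1 | (x.1 + x.2 + d <= M.+1) && (M < x.1 + x.2 + q.+1)]%N.
have Z_le : (d * #|Z| + #|B| <= #|A|)%N.
  (* For each [j < d], a monomial of degree [M - j] is determined by its first two
     exponents. *)
  pose g (y : 'I_d * ('I_q.+1 * 'I_q.+1)) : 'I_q.+1 * 'I_q.+1 * 'I_q.+1 :=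
    (y.2, inord (M - y.1 - y.2.1 - y.2.2)).
  pose SZ := finset.setX [set: 'I_d]%SET [set x in Z]%SET.
  have bounds y : y \in SZ -> [/\ M - y.1 - y.2.1 - y.2.2 < q.+1,
      y.1 + y.2.1 + y.2.2 <= M & y.1 < d]%N.
    case: y => j [a b]; rewrite !inE /= => h; split; move: h (ltn_ord j); clear; lia.
  have g_inj : {in SZ &, injective g}.
    move=> [j [a b]] [j' [a' b']] /bounds[/= h1 h2 h3] /bounds[/= h1' h2' h3'] e.
    have [ea eb] : a = a' /\ b = b' by have := congr1 fst e; case.
    have := congr1 (fun t => nat_of_ord t.2) e; rewrite /g /= !inordK //.
    rewrite ea eb in h2 h2' * => ej.
    by congr (_, (_, _)); apply: val_inj => /=; move: ej h2 h2'; clear; lia.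
  rewrite -[d in (d * _)%N]card_ord -cardsT -(cardsE Z) -cardsX -/SZ -(card_in_imset g_inj).
  rewrite -(cardsE B) -(cardsE A) -cardsUI; set X := (g @: SZ)%SET.
  have -> : (X :&: [set x in B])%SET = finset.set0.
    apply/finset.setP => t; rewrite !inE; apply/negP => /andP[/imsetP[[j [a b]] ySZ ->]].
    have [/= h1 h2 h3] := bounds _ ySZ; rewrite /g /= /= inordK // => hB.
    by move: h2 h3 hB; clear; lia.
  rewrite cards0 addn0; apply/subset_leq_card/fintype.subsetP => t; rewrite !inE.
  case/orP => [/imsetP[[j [a b]] ySZ ->]|]; last by apply: leq_trans; apply: leq_addr.
  by have [/= h1 h2 h3] := bounds _ ySZ; rewrite /g /= inordK //; move: h2 h3; clear; lia.
have Z_ge : (q.+1 * q.+1 <= #|Z| + (q.+1./2 + d + 2) * (q.+1./2 + d + 2))%N.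
  pose s := (q.+1./2 + d)%N.
  have e : #|{: 'I_q.+1 * 'I_q.+1}| = (q.+1 * q.+1)%N by rewrite card_prod card_ord.
  rewrite -e -(cardC Z) leq_add2l.
  pose P := [pred x : 'I_q.+1 * 'I_q.+1 | x.1 + x.2 <= s]%N.
  pose r (x : 'I_q.+1 * 'I_q.+1) := (rev_ord x.1, rev_ord x.2).
  have r_inj : injective r.
    move=> [a b] [a' b'] e'.
    have ea : a = a' := rev_ord_inj (congr1 fst e').
    have eb : b = b' := rev_ord_inj (congr1 snd e').
    by rewrite ea eb.
  (* The two inequalities defining [Z] fail only in two opposite corner triangles, exchanged by the
     reflection [r]. *)
  have sub : [predC Z] \subset [predU P & [preim r of P]].
    apply/fintype.subsetP => -[a b]; rewrite !inE /= /M /s.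
    by have := ltn_ord a; have := ltn_ord b; clear; lia.
  apply: leq_trans (subset_leq_card sub) _.
  have leU : (#|[predU P & [preim r of P]]| <= #|P| + #|[preim r of P]|)%N.
    by rewrite -cardUI leq_addr.
  apply: leq_trans leU _.
  have leP : (#|[preim r of P]| <= #|P|)%N.
    rewrite -(card_image r_inj); apply/subset_leq_card/fintype.subsetP => y.
    by case/fintype.imageP=> x hx ->.
  apply: leq_trans (leq_add (leqnn _) leP) _; rewrite addnn -mul2n !addn2.
  exact: card_small_sum_le.
move: Z_ge; set Q := (q.+1 * q.+1)%N; set C := (_ * (_ + 2))%N => Z_ge.
have := leq_mul (leqnn d) Z_ge; rewrite mulnBr mulnDr.
by move: (HK f q.+1) (d * Q)%N (d * C)%N (d * #|Z|)%N hAB Z_le => h x y z; clear; lia.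
Qed.

(** * Curves that are monic in x *)

(** In the three curves every monomial of [h] has coefficient 1, so a list of exponents encodes
    [h]. *)
Definition monic_curve (k : fieldType) (d : nat) (l : seq (nat * nat * nat)) :=
  mon k d 0 0 - \sum_(s <- l) mon k s.1.1 s.1.2 s.2.

(** Replacing [x^d] by [h] lowers the exponent of [x], so the reduction ends with that exponent
    below [d]. *)
Lemma monic_curve_spans (k : fieldType) (q d : nat) (l : seq (nat * nat * nat)) :
  all (fun s => s.1.1 < d)%N l ->
  forall a, spans_mod (HK_ideal (monic_curve k d l) q)
    (fun x : 'I_d * ('I_q * 'I_q) => mon k x.1 x.2.1 x.2.2) a.
Proof.
move=> /allP hl; set I := HK_ideal _ _; set e := fun x => _.
have sI : subspace I := subspace_HK_ideal q _.
have sS := subspace_spans_mod e sI.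
apply: (subspace_mon (P := spans_mod I e) sS) => a; elim/ltn_ind: a => a IH b c.
have [hbc|] := boolP ((q <= b) || (q <= c))%N.
  by apply/spans_mod_ideal/HK_ideal_mon; rewrite hbc orbT.
rewrite negb_or -!ltnNge => /andP[hb hc]; have [ad|da] := ltnP a d.
  exact: (@spans_mod_gen _ _ _ _ e (Ordinal ad, (Ordinal hb, Ordinal hc)) sI).
have -> : mon k a b c = mon k (a - d) b c * monic_curve k d l
    + \sum_(s <- l) mon k (a - d + s.1.1) (b + s.1.2) (c + s.2).
  rewrite mulrBr monM subnK // !addn0 mulr_sumr.
  by under [X in _ - X + _]eq_bigr do rewrite monM; rewrite subrK.
apply: subspaceD => //; first exact/spans_mod_ideal/HK_ideal_curve.
rewrite big_seq; elim/big_ind: _ => [||s sl]; first by case: sS.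
  by move=> x y; apply: subspaceD.
by apply: IH; have := hl s sl; move: da; clear; lia.
Qed.

Definition homog2 (k : fieldType) (E : nat) (phi : {poly k}) : {mpoly k[3]} :=
  \sum_(s < E.+1) phi`_s *: mon k 0 s (E - s).

(* The matrix of multiplication by [homog2 E phi] on [k[y,z]/(y^q,z^q)]. *)
Definition toeplitz (k : fieldType) (phi : {poly k}) (E q : nat)
    (i j : 'I_q * 'I_q) : k :=
  if (j.1 + j.2 == i.1 + i.2 + E)%N && (i.1 <= j.1)%N then phi`_(j.1 - i.1) else 0.

Lemma toeplitzE (k : fieldType) (phi : {poly k}) (E q : nat) (i j : 'I_q * 'I_q) :
  (size phi <= E.+1)%N ->
  toeplitz phi E i j = \sum_(s < E.+1)
    if (j.1 == i.1 + s :> nat)%N && (j.2 == i.2 + (E - s) :> nat)%N then phi`_s else 0.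
Proof.
move=> sphi; rewrite /toeplitz; case: ifP => [/andP[/eqP e le]|ne]; last first.
  rewrite big1 // => s _; case: ifP => // /andP[/eqP e1 /eqP e2].
  by move: ne; rewrite e1 e2; have := ltn_ord s; clear; lia.
have [lt|lt] := ltnP (j.1 - i.1)%N E.+1.
  rewrite (bigD1 (Ordinal lt)) //= big1 ?addr0 => [|s ns].
    by rewrite ifT //; move: e le lt; clear; lia.
  case: ifP => // /andP[/eqP e1 _]; case/eqP: ns; apply: val_inj => /=.
  by move: e1; clear; lia.
rewrite nth_default ?(leq_trans sphi) // big1 // => s _.
case: ifP => // /andP[/eqP e1 _]; move: lt e1 (ltn_ord s); clear; lia.
Qed.

(** The combination is the product of a monomial with the form, less the terms divisible by [y^q] or
    [z^q]; all of these lie in the ideal. *)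
Lemma toeplitz_row (k : fieldType) (phi : {poly k}) (E q : nat) (f : {mpoly k[3]})
    (d : nat) (i : 'I_q * 'I_q) :
  (size phi <= E.+1)%N ->
  HK_ideal f q (homog2 E phi) ->
  HK_ideal f q (\sum_j toeplitz phi E i j *: mon k d j.1 j.2).
Proof.
move=> sphi IG; have sI := subspace_HK_ideal q f.
rewrite -[X in HK_ideal _ _ X](subrK (mon k d i.1 i.2 * homog2 E phi)).
apply: subspaceD => //; last exact: ideal_genM.
have -> : \sum_j toeplitz phi E i j *: mon k d j.1 j.2 =
   \sum_(s < E.+1) if (i.1 + s < q)%N && (i.2 + (E - s) < q)%N
     then phi`_s *: mon k d (i.1 + s) (i.2 + (E - s)) else 0.
  under eq_bigr do rewrite toeplitzE // scaler_suml.
  rewrite exchange_big /=; apply: eq_bigr => s _.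
  case: ifP => [/andP[h1 h2]|h].
    rewrite (bigD1 (Ordinal h1, Ordinal h2)) //= !eqxx big1 ?addr0 // => j nj.
    case: ifP => [/andP[/eqP e1 /eqP e2]|]; last by rewrite scale0r.
    case/eqP: nj; case: j e1 e2 => j1 j2 /= e1 e2.
    by congr (_, _); apply: val_inj.
  rewrite big1 // => j _; case: ifP => [/andP[/eqP e1 /eqP e2]|]; last by rewrite scale0r.
  by move: h; rewrite -e1 -e2 !ltn_ord.
rewrite mulr_sumr -sumrB; apply: subspace_sum => // s _.
rewrite -scalerAr monM addn0; case: ifP => [_|h]; first by rewrite subrr; case: sI.
rewrite sub0r -scaleNr; apply: subspaceZ => //; apply: HK_ideal_mon.
by move: h; clear; lia.
Qed.

Lemma sum_pair (V : nmodType) (S T : finType) (F : S * T -> V) :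
  \sum_x F x = \sum_a \sum_b F (a, b).
Proof. by rewrite pair_bigA; apply: eq_bigr => -[]. Qed.

(** A relation between rows splits by degree, and its part of degree [l <= m] is a polynomial [c].
    The coefficients of [c * phi] that [nondegenerate] examines in degree [m] correspond to columns
    of degree [l + E], or exceed the degree of the product. *)
Lemma toeplitz_free (k : fieldType) (phi : {poly k}) (E q m : nat)
    (v : 'I_q * 'I_q -> k) :
  (size phi <= E.+1)%N -> (m < q)%N -> nondegenerate phi E m q ->
  (forall j, \sum_(i in small_sums q m) v i * toeplitz phi E i j = 0) ->
  forall i, i \in small_sums q m -> v i = 0.
Proof.
case: q v => // q v sphi mq nd hv [i1 i2]; rewrite inE /= => hi.
pose l := (i1 + i2)%N.
pose c := \poly_(a < l.+1) v (inord a, inord (l - a)).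
suff c0 : c = 0.
  have := congr1 (fun r : {poly k} => r`_i1) c0; rewrite coef0 coef_poly ltnS leq_addr.
  by rewrite /l addKn !inord_val.
apply: nd => [|t tq ht]; first by apply: leq_trans (size_poly _ _) _; rewrite ltnS.
rewrite coefM; have [tl|tl] := leqP t (l + E); last first.
  rewrite big1 // => a _; rewrite coef_poly; case: ifP => [al|]; last by rewrite mul0r.
  rewrite [phi`_ _]nth_default ?mulr0 //; apply: leq_trans sphi _.
  by move: al tl (ltn_ord a); clear; lia.
have ht2 : (l + E - t < q.+1)%N by move: ht tl tq hi; rewrite -/l; clear; lia.
rewrite -[RHS](hv (Ordinal tq, Ordinal ht2)).
rewrite (big_ord_widen q.+1 (fun a => c`_a * phi`_(t - a))) //.
rewrite big_mkcond [RHS]big_mkcond /=.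
rewrite sum_pair /=.
apply: eq_bigr => a _; rewrite coef_poly !ltnS /toeplitz /= subnKC //.
case: (leqP a l) => [al|la]; last first.
  rewrite big1 ?mul0r ?if_same // => b _; rewrite [X in v _ * X]ifF ?mulr0 ?if_same //.
  by move: la; clear; lia.
have hla : (l - a < q.+1)%N by move: hi mq; rewrite -/l; clear; lia.
rewrite (bigD1 (inord (l - a))) //= big1 ?addr0 => [|b nb]; last first.
  rewrite [X in v _ * X]ifF ?mulr0 ?if_same //; apply: contraNF nb => /andP[/eqP e _].
  by apply/eqP/val_inj; rewrite /= inordK //; move: e al; clear; lia.
rewrite inE /= !inordK // subnKC // hi eqxx inord_val /=.
by case: ifP; rewrite ?mulr0.
Qed.

(** Reversing both exponents pairs monomials with product [y^(q-1) z^(q-1)], and multiplication by a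
    form is symmetric for this duality. [mxrank_reversal] then applies to [small_sums q m]; the
    bound on [2 * m + E] yields the zero block by degrees. *)
Lemma HK_monic_curve_le (k : fieldType) (q d E m : nat) (l : seq (nat * nat * nat))
    (phi : {poly k}) :
  all (fun s => s.1.1 < d)%N l -> (size phi <= E.+1)%N -> (m < q)%N ->
  (2 * m + E + 2 < 2 * q)%N -> nondegenerate phi E m q ->
  HK_ideal (monic_curve k d l) q (homog2 E phi) ->
  (HK (monic_curve k d l) q <= d * (q * q - m.+1 * m.+1))%N.
Proof.
move=> hl sphi mq hE nd IG.
have := quot_dim_le_mxrank (subspace_HK_ideal q _) (monic_curve_spans q hl)
  (fun (c : 'I_d) i => toeplitz_row c i sphi IG).
move/leq_trans; apply; apply: leq_mul; first by rewrite card_ord.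
apply: leq_sub; first by rewrite card_prod card_ord.
apply: leq_trans (card_small_sum_ge mq) _.
apply: (mxrank_reversal (rho := fun x => (rev_ord x.1, rev_ord x.2))).
- by move=> [x1 x2]; rewrite /= !rev_ordK.
- move=> [i1 i2] [j1 j2]; rewrite /toeplitz /=.
  have := ltn_ord i1; have := ltn_ord i2; have := ltn_ord j1; have := ltn_ord j2.
  move=> l1 l2 l3 l4.
  have -> : (q - i1.+1 - (q - j1.+1) = j1 - i1)%N by move: l2 l4; clear; lia.
  by congr (if _ then _ else _); move: l1 l2 l3 l4; clear; lia.
- move=> [i1 i2] [j1 j2]; rewrite !inE /toeplitz /= => hi hj; rewrite ifF //.
  by move: hi hj hE (ltn_ord j1) (ltn_ord j2); clear; lia.
- by move=> v; apply: toeplitz_free sphi mq nd.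
Qed.

Lemma homog2D (k : fieldType) (E : nat) (phi psi : {poly k}) :
  homog2 E (phi + psi) = homog2 E phi + homog2 E psi.
Proof.
by rewrite -big_split; apply: eq_bigr => s _; rewrite coefD scalerDl.
Qed.

Lemma homog2Z (k : fieldType) (E : nat) (c : k) (phi : {poly k}) :
  homog2 E (c *: phi) = c *: homog2 E phi.
Proof.
by rewrite /homog2 scaler_sumr; apply: eq_bigr => s _; rewrite coefZ scalerA.
Qed.

Lemma homog2_sum (k : fieldType) (E : nat) (T : finType) (F : T -> {poly k}) :
  homog2 E (\sum_t F t) = \sum_t homog2 E (F t).
Proof.
rewrite /homog2 exchange_big; apply: eq_bigr => s _.
by rewrite coef_sum scaler_suml.
Qed.

Lemma homog2Xn (k : fieldType) (E s : nat) :
  (s <= E)%N -> homog2 E ('X^s : {poly k}) = mon k 0 s (E - s).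
Proof.
move=> sE; rewrite /homog2 (bigD1 (Ordinal (sE : s < E.+1)%N)) //=.
rewrite coefXn eqxx scale1r big1 ?addr0 // => i ni.
by rewrite coefXn (_ : (_ == _) = false) ?scale0r //; apply: contraNF ni.
Qed.

Lemma homog2M (k : fieldType) (E F : nat) (phi psi : {poly k}) :
  (size phi <= E.+1)%N -> (size psi <= F.+1)%N ->
  homog2 (E + F) (phi * psi) = homog2 E phi * homog2 F psi.
Proof.
have expand G (r : {poly k}) : (size r <= G.+1)%N -> r = \sum_(s < G.+1) r`_s *: 'X^s.
  move=> sr; rewrite -poly_def; apply/polyP=> i; rewrite coef_poly.
  by case: ltnP => // Gi; rewrite nth_default // (leq_trans sr).
move=> /expand ephi /expand epsi; rewrite {1}ephi {1}epsi mulr_suml homog2_sum.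
rewrite /homog2 mulr_suml; apply: eq_bigr => s _; rewrite -/(homog2 _ _) mulr_sumr homog2_sum.
rewrite mulr_sumr; apply: eq_bigr => t _.
rewrite -scalerAl -scalerAr -scalerAl -scalerAr !homog2Z -exprD.
have hs := ltn_ord s; have ht := ltn_ord t.
rewrite homog2Xn; last by rewrite leq_add.
rewrite monM; congr (_ *: (_ *: mon _ _ _ _)).
by move: hs ht; clear; lia.
Qed.

Lemma homog2X (k : fieldType) (E e : nat) (phi : {poly k}) :
  (size phi <= E.+1)%N -> homog2 (E * e) (phi ^+ e) = homog2 E phi ^+ e.
Proof.
move=> sphi; elim: e => [|e IH].
  rewrite muln0 !expr0 -[1 in LHS](expr0 'X) homog2Xn //.
  by rewrite monE !expr0 !mulr1.
rewrite mulnS exprS homog2M ?IH ?exprS //.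
apply: leq_trans (size_poly_exp_leq _ _) _; rewrite ltnS leq_mul2r.
by apply/orP; right; move: sphi; clear; lia.
Qed.

(** The curve [x^d - h] divides [x^(d e) - h^e], and [x^(d e)] is in the ideal as [q <= d * e]. *)
Lemma HK_ideal_monic_curveX (k : fieldType) (q d e : nat) (l : seq (nat * nat * nat)) :
  (q <= d * e)%N ->
  HK_ideal (monic_curve k d l) q ((\sum_(s <- l) mon k s.1.1 s.1.2 s.2) ^+ e).
Proof.
move=> qde; have sI := subspace_HK_ideal q (monic_curve k d l).
have := subrXX (mon k d 0 0) (\sum_(s <- l) mon k s.1.1 s.1.2 s.2) e.
rewrite -/(monic_curve k d l) => eX.
rewrite -[X in HK_ideal _ _ X](subKr (mon k d 0 0 ^+ e)); apply: subspaceB => //.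
  have -> : mon k d 0 0 ^+ e = mon k (d * e) 0 0.
    by rewrite !monE !expr0 !mulr1 exprM.
  by apply: HK_ideal_mon; rewrite qde.
by rewrite eX mulrC; apply: HK_ideal_curve.
Qed.

Lemma plane_curve_monic (k : fieldType) (d : nat) (l : seq (nat * nat * nat)) :
  all (fun s => (s.1.1 < d) && (s.1.1 + s.1.2 + s.2 == d))%N l ->
  plane_curve d (monic_curve k d l).
Proof.
move=> /allP hl; split.
  apply/negP => /eqP /(congr1 (mcoeff (mnm3 d 0 0))); apply/eqP.
  rewrite mcoeff0 mcoeffB mcoeffX eqxx raddf_sum big_seq big1 ?subr0 ?oner_eq0 //.
  move=> s /hl /andP[lt _]; rewrite /= mcoeffX; case: eqP => // /mnm3_inj[e _ _].
  by move: lt; rewrite e ltnn.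
have hmon a b c : (a + b + c)%N = d -> mon k a b c \is d.-homog.
  by move=> <-; rewrite /mon dhomogX /= mdeg_mnm3.
rewrite rpredB ?hmon ?addn0 // big_seq; apply: rpred_sum => s /hl /andP[_ /eqP].
exact: hmon.
Qed.

(** * Three explicit curves and their products *)

(** The bound is [3/4 d q^2 + O(q)], with an error term that fits all three curves. It is linear in
    [d], hence stable under products. *)
Definition near_minimal (k : fieldType) (d q : nat) (f : {mpoly k[3]}) :=
  (HK f q <= d * (q * q - (q./2 - 3) * (q./2 - 3)))%N.

Lemma near_minimal_conic (k : fieldType) (q : nat) :
  (8 <= q)%N -> near_minimal 2 q (monic_curve k 2 [:: (0, 1, 1)%N]).
Proof.
(* The least [e] with [q <= 2 * e], so that [x^(2 e)], and with it [(y z)^e], is in the ideal. *)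
move=> q8; set l := [:: _]; pose e := uphalf q.
(* The parameter [m] is [q./2 - 4], a true difference because [8 <= q]. *)
have m_eq : (q./2 - 4).+1 = (q./2 - 3)%N by lia.
rewrite /near_minimal -m_eq.
apply: (@HK_monic_curve_le _ _ _ (2 * e) _ _ ('X^e)) => //.
- by rewrite size_polyXn; lia.
- lia.
- by rewrite /e; lia.
- by apply: nondegenerate_conic; rewrite /e; lia.
rewrite homog2Xn; last by lia.
have -> : mon k 0 e (2 * e - e) = (\sum_(s <- l) mon k s.1.1 s.1.2 s.2) ^+ e.
  by rewrite big_seq1 /= !monE mul2n -addnn addnK !expr0 !mul1r exprMn.
by apply: HK_ideal_monic_curveX; rewrite /e; lia.
Qed.

Lemma near_minimal_cubic (k : fieldType) (p n : nat) :
  p \in [pchar k] -> p != 3 -> (8 <= p ^ n)%N ->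
  near_minimal 3 (p ^ n) (monic_curve k 3 [:: (0, 2, 1)%N; (0, 1, 2)%N]).
Proof.
move=> pc p3; set l := [:: _; _]; set q := (p ^ n)%N => q8; pose e := ((q + 2) %/ 3)%N.
have m_eq : (q./2 - 4).+1 = (q./2 - 3)%N by lia.
have he : (q <= 3 * e <= q + 2)%N by rewrite /e; lia.
rewrite /near_minimal -m_eq.
apply: (@HK_monic_curve_le _ _ _ (3 * e) _ _ ('X^e * ('X + 1) ^+ e)) => //.
- apply: leq_trans (size_mul_leqf _ _) _.
  have := size_poly_exp_leq ('X + 1 : {poly k}) e; rewrite size_XaddC size_polyXn.
  by clear; lia.
- lia.
- by move: he; lia.
- by apply: nondegenerate_cubic => //; rewrite -/q; lia.
rewrite -exprMn homog2X; last first.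
  apply: leq_trans (size_mul_leqf _ _) _.
  by rewrite size_XaddC size_polyX.
have -> : homog2 3 ('X * ('X + 1) : {poly k}) = \sum_(s <- l) mon k s.1.1 s.1.2 s.2.
  rewrite mulrDr mulr1 -expr2 -{2}['X]expr1 homog2D !homog2Xn //.
  by rewrite big_cons big_seq1.
by apply: HK_ideal_monic_curveX; case/andP: he.
Qed.

(** By induction: cube the identity, then replace [x^3] by [x z^2 + y^2 z]. The [y^2 z] part
    contributes the new term of the truncated series. *)
Lemma artin_schreier_frobenius (k : fieldType) (n : nat) : 3 \in [pchar k] ->
  exists w, mon k (3 ^ n) 0 0 =
    homog2 (3 ^ n) (artin_schreier k n) + mon k 1 0 (3 ^ n - 1)
    + w * monic_curve k 3 [:: (1, 0, 2)%N; (0, 2, 1)%N].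
Proof.
move=> pc; set f := monic_curve _ _ _.
have pcP : 3 \in [pchar {mpoly k[3]}].
  by rewrite inE /= -mpolyC_nat (pcharf0 pc) mpolyC0.
elim: n => [|n [w ew]].
  exists 0; rewrite mul0r addr0 /artin_schreier big_ord0 /homog2 big1 ?add0r // => s _.
  by rewrite coef0 scale0r.
have lt2 j : (j < n)%N -> (2 * 3 ^ j <= 3 ^ n)%N.
  move=> jn; apply: (@leq_trans (3 ^ j.+1)); last by rewrite leq_exp2l.
  by rewrite expnS leq_mul2r orbT.
have cube a b c : mon k a b c ^+ 3 = mon k (3 * a) (3 * b) (3 * c).
  by rewrite !monE !exprMn -!exprM ![(3 * _)%N]mulnC.
have cubeD (x y : {mpoly k[3]}) : (x + y) ^+ 3 = x ^+ 3 + y ^+ 3.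
  by rewrite -!(pFrobenius_autE pcP) pFrobenius_autD_comm //; apply: mulrC.
have n_gt0 : (0 < 3 ^ n)%N by rewrite expn_gt0.
have eS : homog2 (3 ^ n.+1) (artin_schreier k n.+1) =
    mon k 0 2 (3 ^ n.+1 - 2) + homog2 (3 ^ n) (artin_schreier k n) ^+ 3.
  rewrite /artin_schreier big_ord_recl homog2D expn0 muln1 homog2Xn; last first.
    by rewrite expnS; move: n_gt0; clear; lia.
  congr (_ + _); rewrite !homog2_sum.
  have -> (F : 'I_n -> {mpoly k[3]}) : (\sum_j F j) ^+ 3 = \sum_j F j ^+ 3.
    by elim/big_rec2: _ => [|i x y _ <-]; rewrite ?expr0n // cubeD.
  apply: eq_bigr => j _; have hj := lt2 j (ltn_ord j).
  have hj' : (2 * 3 ^ j.+1 <= 3 ^ n.+1)%N by rewrite !expnS mulnCA leq_mul2l hj.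
  rewrite lift0 (homog2Xn k hj') (homog2Xn k hj) cube muln0 mulnBr mulnCA.
  by rewrite -!expnS.
have ef : mon k 3 0 0 = f + mon k 1 0 2 + mon k 0 2 1.
  by rewrite /f /monic_curve big_cons big_seq1 /= -addrA subrK.
(* The first summand comes from replacing [x^3] in [x^3 z^(3^(n+1) - 3)], the second from the cube
   of [w * f]. *)
exists (mon k 0 0 (3 ^ n.+1 - 3) + w ^+ 3 * f ^+ 2).
have -> : mon k (3 ^ n.+1) 0 0 = mon k (3 ^ n) 0 0 ^+ 3 by rewrite cube !muln0 expnS.
rewrite ew !cubeD eS cube !muln0 muln1.
have -> : mon k 3 0 (3 * (3 ^ n - 1)) = mon k 0 0 (3 ^ n.+1 - 3) * mon k 3 0 0.
  by rewrite monM mulnBr -expnS muln1 !addn0.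
have le3 : (3 <= 3 ^ n.+1)%N by rewrite expnS leq_pmulr.
rewrite ef; clearbody f; rewrite !mulrDr !monM !add0n.
have -> : (3 ^ n.+1 - 3 + 2 = 3 ^ n.+1 - 1)%N by move: le3; clear; lia.
have -> : (3 ^ n.+1 - 3 + 1 = 3 ^ n.+1 - 2)%N by move: le3; clear; lia.
rewrite exprMn; ring.
Qed.

(** Modulo the curve the form of degree [q] is [x^q - x z^(q-1)]. One more factor [z] brings it into
    the ideal, hence the degree [q + 1]. *)
Lemma near_minimal_artin_schreier (k : fieldType) (n : nat) :
  3 \in [pchar k] -> (8 <= 3 ^ n)%N ->
  near_minimal 3 (3 ^ n) (monic_curve k 3 [:: (1, 0, 2)%N; (0, 2, 1)%N]).
Proof.
move=> pc; have [w] := artin_schreier_frobenius n pc.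
set l := [:: _; _]; set q := (3 ^ n)%N => ew q8.
have m_eq : (q./2 - 4).+1 = (q./2 - 3)%N by lia.
rewrite /near_minimal -m_eq.
have le_s (j : 'I_n) : (2 * 3 ^ j <= q)%N.
  apply: (@leq_trans (3 ^ j.+1)); last by rewrite leq_exp2l.
  by rewrite expnS leq_mul2r orbT.
apply: (@HK_monic_curve_le _ _ _ (q + 1) _ _ (artin_schreier k n)) => //.
- apply: leq_trans (size_sum _ _ _) _; apply/bigmax_leqP => j _.
  by rewrite size_polyXn; have := le_s j; clear; lia.
- lia.
- lia.
- by apply: nondegenerate_artin_schreier => //; rewrite -/q; lia.
have sI := subspace_HK_ideal q (monic_curve k 3 l).
have -> : homog2 (q + 1) (artin_schreier k n) = mon k 0 0 1 * homog2 q (artin_schreier k n).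
  rewrite /artin_schreier !homog2_sum mulr_sumr; apply: eq_bigr => j _.
  have := le_s j => hj; rewrite !homog2Xn ?monM //; last by move: hj; clear; lia.
  by congr mon; move: hj; clear; lia.
move: (monic_curve k 3 l) sI ew => f sI ew.
have -> : homog2 q (artin_schreier k n) = mon k q 0 0 - w * f - mon k 1 0 (q - 1).
  by rewrite ew addrK addrK.
rewrite !mulrBr !monM; apply: subspaceB => //; last first.
  by apply: HK_ideal_mon; move: q8; clear; lia.
apply: subspaceB => //; first by apply: HK_ideal_mon; rewrite add0n leqnn.
by rewrite mulrA; apply: HK_ideal_curve.
Qed.

Lemma near_minimal_mul (k : fieldType) (q d e : nat) (f g : {mpoly k[3]}) :
  near_minimal d q f -> near_minimal e q g -> near_minimal (d + e) q (f * g).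
Proof.
move=> hf hg; apply: leq_trans (HK_mul _ _ _) _.
by rewrite mulnDl; apply: leq_add.
Qed.

Lemma plane_curve_mul (k : fieldType) (d e : nat) (f g : {mpoly k[3]}) :
  plane_curve d f -> plane_curve e g -> plane_curve (d + e) (f * g).
Proof.
by move=> [f0 hf] [g0 hg]; split; [rewrite mulf_neq0 | apply: dhomogM].
Qed.

(** Conic factors are split off until degree 2 or 3 remains; the characteristic decides which cubic
    is used. *)
Lemma near_minimal_curve (k : fieldType) (p d : nat) :
  p \in [pchar k] -> (2 <= d)%N ->
  exists f : {mpoly k[3]}, plane_curve d f /\
    forall n, (8 <= p ^ n)%N -> near_minimal d (p ^ n) f.
Proof.
move=> pc; elim/ltn_ind: d => d IH d2.
have [d4|] := leqP 4 d.
  have [||f [cf nf]] := IH (d - 2)%N; [lia|lia|].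
  exists (monic_curve k 2 [:: (0, 1, 1)%N] * f).
  rewrite -(subnKC d2); split.
    by apply: plane_curve_mul cf; apply: plane_curve_monic.
  by move=> n q8; apply: near_minimal_mul (nf n q8); apply: near_minimal_conic.
move=> d4; have [->|->] : d = 2 \/ d = 3 by lia.
  exists (monic_curve k 2 [:: (0, 1, 1)%N]); split; first exact: plane_curve_monic.
  by move=> n; apply: near_minimal_conic.
have [p3|p3] := eqVneq p 3.
  exists (monic_curve k 3 [:: (1, 0, 2)%N; (0, 2, 1)%N]); split.
    exact: plane_curve_monic.
  by move=> n; rewrite p3; apply: near_minimal_artin_schreier; rewrite -p3.
exists (monic_curve k 3 [:: (0, 2, 1)%N; (0, 1, 2)%N]); split.
  exact: plane_curve_monic.
by move=> n; apply: near_minimal_cubic.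
Qed.

(** * Passage to the limit *)

Lemma half_bounds (R : realType) (q : nat) :
  (q./2%:R <= q%:R / 2 :> R) /\ (q%:R / 2 - 1 / 2 <= q./2%:R :> R).
Proof.
have : q%:R = (odd q)%:R + 2 * (q./2%:R) :> R.
  by rewrite -{1}(odd_double_half q) natrD -mul2n natrM.
by case: (odd q) => /= e; lra.
Qed.

Lemma HK_ratio_ge (R : realType) (k : fieldType) (q d : nat) (f : {mpoly k[3]}) :
  (0 < d)%N -> (0 < q)%N -> f \is d.-homog ->
  3 / 4 * d%:R - (d * (d + 2) * (d + 3))%:R / q%:R <= (HK f q)%:R / q%:R ^+ 2 :> R.
Proof.
move=> d_gt0 q_gt0 hf; have := HK_ge q d_gt0 hf; set C := (q./2 + d + 2)%N => hHK.
have q1 : 1 <= q%:R :> R by rewrite ler1n.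
have [hq _] := half_bounds R q.
have hC : C%:R <= q%:R / 2 + d%:R + 2 :> R by rewrite /C !natrD; lra.
clearbody C.
have hsub : (q * q)%:R - (C * C)%:R <= (q * q - C * C)%:R :> R.
  by rewrite lerBlDr -natrD ler_nat addnC -leq_subLR.
have dR : 1 <= d%:R :> R by rewrite ler1n.
have h1 : d%:R * ((q * q)%:R - (C * C)%:R) <= (HK f q)%:R :> R.
  apply: le_trans (_ : (d * (q * q - C * C))%:R <= _); last by rewrite ler_nat.
  by rewrite (natrM R d) ler_wpM2l // ler0n.
rewrite ler_pdivlMr ?exprn_gt0 ?(lt_le_trans ltr01 q1) //; apply: le_trans h1.
have q0 : q%:R != 0 :> R by rewrite pnatr_eq0 -lt0n.
have -> : (3 / 4 * d%:R - (d * (d + 2) * (d + 3))%:R / q%:R) * q%:R ^+ 2 =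
  3 / 4 * d%:R * q%:R ^+ 2 - (d * (d + 2) * (d + 3))%:R * q%:R :> R by field.
rewrite !natrM !natrD.
have hCC : C%:R * C%:R <= (q%:R / 2 + d%:R + 2) * (q%:R / 2 + d%:R + 2) :> R.
  by apply: ler_pM; rewrite ?ler0n.
(* As [q >= 1], the constant [(d + 2)^2] of the square is absorbed in the linear term, whose
   coefficient becomes [(d + 2) + (d + 2)^2 = (d + 2) (d + 3)]. *)
have key : 0 <= (d%:R + 2) * (d%:R + 2) * (q%:R - 1) :> R.
  by apply: mulr_ge0; [apply: mulr_ge0; lra | lra].
have : 3 / 4 * q%:R ^+ 2 - (d%:R + 2) * (d%:R + 3) * q%:R <= q%:R * q%:R - C%:R * C%:R :> R.
  by move: hCC key; rewrite expr2; move: (C%:R * C%:R) => CC; lra.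
move=> /(ler_wpM2l (ler0n R d)); apply: le_trans.
by rewrite le_eqVlt; apply/orP; left; apply/eqP; ring.
Qed.

(** Since [q./2 - 3] is at least [q/2 - 7/2], which is positive, the linear error is at most
    [7/2 d q], rounded up to [4 d q]. *)
Lemma HK_ratio_le (R : realType) (k : fieldType) (q d : nat) (f : {mpoly k[3]}) :
  (8 <= q)%N -> near_minimal d q f ->
  (HK f q)%:R / q%:R ^+ 2 <= 3 / 4 * d%:R + (4 * d)%:R / q%:R :> R.
Proof.
move=> q8 hf; have q8R : 8 <= q%:R :> R by rewrite ler_nat.
have [hq1 hq2] := half_bounds R q.
rewrite ler_pdivrMr ?exprn_gt0 //; last by lra.
have q0 : q%:R != 0 :> R by apply/eqP; lra.
have -> : (3 / 4 * d%:R + (4 * d)%:R / q%:R) * q%:R ^+ 2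
  = d%:R * (3 / 4 * q%:R ^+ 2 + 4 * q%:R) :> R by rewrite natrM; field.
have h2 : (3 <= q./2)%N by lia.
apply: le_trans (_ : (d * (q * q - (q./2 - 3) * (q./2 - 3)))%:R <= _).
  by rewrite ler_nat.
rewrite natrM ler_wpM2l ?ler0n // natrB; last by lia.
rewrite !natrM natrB //; nra.
Qed.

Theorem corollary1 (R : realType) (k : fieldType) (p d : nat) :
  p \in [pchar k] -> (2 <= d)%N ->
  (exists f : {mpoly k[3]},
      plane_curve d f /\ HK_multiplicity p f (3 / 4 * d%:R : R)) /\
  (forall (f : {mpoly k[3]}) (c : R),
      plane_curve d f -> HK_multiplicity p f c -> 3 / 4 * d%:R <= c).
Proof.
move=> pc d2; have d_gt0 : (0 < d)%N by apply: ltnW.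
have p_gt1 := prime_gt1 (pcharf_prime pc).
have q_gt0 n : (0 < p ^ n)%N by rewrite expn_gt0 ltnW.
have e2 n : (p ^ (2 * n))%:R = (p ^ n)%:R ^+ 2 :> R by rewrite mulnC expnM natrX.
have inv_cvg (K : R) : (fun n : nat => K / (p ^ n)%:R : R) @ \oo --> (0 : R).
  have := @cvg_geometric R K (p%:R^-1).
  rewrite ger0_norm ?invr_ge0 ?ler0n // invf_lt1 ?ltr0n ?ltr1n ?(ltnW p_gt1) // => /(_ p_gt1).
  by apply: cvg_trans; apply: near_eq_cvg; near=> n; rewrite /geometric /= natrX exprVn.
have low f : f \is d.-homog -> forall n,
   3 / 4 * d%:R - (d * (d + 2) * (d + 3))%:R / (p ^ n)%:R
     <= (HK f (p ^ n))%:R / (p ^ (2 * n))%:R :> R.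
  by move=> hf n; rewrite e2; apply: HK_ratio_ge.
have low_cvg : (fun n => 3 / 4 * d%:R - (d * (d + 2) * (d + 3))%:R / (p ^ n)%:R : R)
    @ \oo --> (3 / 4 * d%:R : R).
  rewrite -[X in _ --> X]subr0; apply: cvgB; first exact: cvg_cst.
  exact: inv_cvg.
split; last first.
  move=> f c [_ hf] hc; apply: (ler_cvg_to low_cvg hc).
  by near=> n; apply: low.
have [f [cf nf]] := near_minimal_curve pc d2; exists f; split=> //.
apply: (squeeze_cvgr _ low_cvg (h := fun n => 3 / 4 * d%:R + (4 * d)%:R / (p ^ n)%:R)).
  (* From [n = 3] on, [p ^ n >= 2 ^ 3] meets the condition of [near_minimal_curve]. *)
  near=> n; have n3 : (3 <= n)%N by near: n; exists 3.
  have q8 : (8 <= p ^ n)%N.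
    by apply: leq_trans (leq_pexp2l (ltnW p_gt1) n3); rewrite -[8%N]/(2 ^ 3)%N leq_exp2r.
  rewrite low /=; last by case: cf.
  by rewrite e2; apply: HK_ratio_le q8 (nf n q8).
rewrite -[X in _ --> X]addr0; apply: cvgD; first exact: cvg_cst.
exact: inv_cvg.
Unshelve. all: by end_near.
Qed.
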